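(* Let $X_0\hookrightarrow X$ be a square zero extension of schemes. Suppose that we have deformations of perfect complexes $E_0$ and $F_0$ to complexes $E$ and $F$ on $X$; in other words, we have exact triangles $$M\to E\to E_0\to M[1]\quad\text{and}\quad N\to F\to F_0\to N[1].$$ Then, given morphisms $f\colon M\to N$ and $\lambda\colon E_0\to F_0$ (together with $f[1]\colon M[1]\to N[1]$), there is an obstruction $o\in\mathrm{Ext}^1(E_0,N)$ whose vanishing is necessary and sufficient for the existence of a morphism $E\to F$ completing these to a morphism of exact triangles $$\begin{array}{ccccccc}M&\to&E&\to&E_0&\to&M[1]\\ \downarrow{\scriptstyle f}&&\downarrow&&\downarrow{\scriptstyle\lambda}&&\downarrow{\scriptstyle f[1]}\\ N&\to&F&\to&F_0&\to&N[1].\end{array}$$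
   Context: All complexes are regarded as objects of the derived category of $X$ (those on $X_0$ via pushforward along $X_0\hookrightarrow X$). In a triangulated category, $\mathrm{Ext}^1(A,B)=\mathrm{Hom}(A,B[1])$. *)

(* Defs.v *)
From HB Require Import structures.
From mathcomp Require Import all_boot all_order all_algebra.
From mathcomp Require Import boolp classical_sets.
From mathcomp Require Import topology_structure subtype_topology.

Set Implicit Arguments.
Unset Strict Implicit.
Unset Printing Implicit Defensive.

Import GRing.Theory.

Local Open Scope classical_set_scope.
Local Open Scope ring_scope.

Record opens (T : topologicalType) := Opens {
  oset :> set T;
  oset_open : open oset }.

(* Sections are only restricted along inclusions of opens; a cover of [U] is a
   set of opens contained in [U], and may be empty (when [U] is). *)
Definition is_sheaf (T : topologicalType) (F : opens T -> Type)
    (res : forall U V : opens T, V `<=` U -> F U -> F V) : Prop :=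
  forall (U : opens T) (C : set (opens T)),
    (forall V, C V -> V `<=` U) ->
    (forall x, oset U x -> exists2 V, C V & oset V x) ->
    forall s : (forall V, C V -> F V),
      (forall V1 V2 (c1 : C V1) (c2 : C V2) (W : opens T)
          (h1 : W `<=` V1) (h2 : W `<=` V2),
          res V1 W h1 (s V1 c1) = res V2 W h2 (s V2 c2)) ->
      exists! t : F U, forall V (c : C V) (h : V `<=` U), res U V h t = s V c.

(* [phi] will be the image along an open immersion, or the preimage along a
   continuous map. *)
Lemma is_sheaf_comp (S T : topologicalType) (phi : opens T -> opens S)
    (mono : forall U V : opens T, V `<=` U -> phi V `<=` phi U)
    (F : opens S -> Type)
    (res : forall U V : opens S, V `<=` U -> F U -> F V) :
  (forall (U : opens S) (h : U `<=` U) s, res U U h s = s) ->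
  (forall (U V W : opens S) (h1 : V `<=` U) (h2 : W `<=` V) (h3 : W `<=` U) s,
      res V W h2 (res U V h1 s) = res U W h3 s) ->
  (forall (U : opens T) (C : set (opens T)),
      (forall V, C V -> V `<=` U) ->
      (forall x, oset U x -> exists2 V, C V & oset V x) ->
      forall y, oset (phi U) y -> exists2 V, C V & oset (phi V) y) ->
  (forall (V1 V2 : opens T) (Z : opens S),
      Z `<=` phi V1 -> Z `<=` phi V2 ->
      exists W : opens T, [/\ W `<=` V1, W `<=` V2 & Z `<=` phi W]) ->
  is_sheaf res ->
  is_sheaf (fun U V h => res (phi U) (phi V) (mono U V h)).
Proof.
move=> res1 resC phicov phicap shF U C CU covU s sC.
pose C' (Z : opens S) := exists2 V, C V & Z `<=` phi V.
pose s' Z (c : C' Z) : F Z :=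
  let: exist2 V cV h := cid2 c in res (phi V) Z h (s V cV).
have s'E Z (c : C' Z) V (cV : C V) (h : Z `<=` phi V) :
    s' Z c = res (phi V) Z h (s V cV).
  rewrite /s'; case: (cid2 c) => V0 cV0 h0.
  have [W [W0 W1 ZW]] := phicap _ _ _ h0 h.
  rewrite -(resC _ _ _ (mono _ _ W0) ZW) -(resC _ _ _ (mono _ _ W1) ZW).
  by rewrite (sC _ _ cV0 cV).
have C'V V : C V -> C' (phi V) by move=> cV; exists V.
have C'U Z : C' Z -> Z `<=` phi U.
  by case=> V cV h; apply: (subset_trans h); exact: (mono _ _ (CU _ cV)).
have covC' y : oset (phi U) y -> exists2 Z, C' Z & oset Z y.
  move=> Uy; have [V cV Vy] := phicov U C CU covU y Uy.
  by exists (phi V) => //; exact: C'V.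
have compat V1 V2 (c1 : C' V1) (c2 : C' V2) (W : opens S)
    (h1 : W `<=` V1) (h2 : W `<=` V2) :
    res V1 W h1 (s' V1 c1) = res V2 W h2 (s' V2 c2).
  case: (c1) => P1 p1 q1; case: (c2) => P2 p2 q2.
  rewrite (s'E _ _ _ p1 q1) (s'E _ _ _ p2 q2).
  rewrite (resC _ _ _ _ _ (subset_trans h1 q1)).
  rewrite (resC _ _ _ _ _ (subset_trans h2 q2)).
  have [Q [Q1 Q2 ZQ]] := phicap _ _ _ (subset_trans h1 q1) (subset_trans h2 q2).
  rewrite -(resC _ _ _ (mono _ _ Q1) ZQ) -(resC _ _ _ (mono _ _ Q2) ZQ).
  by rewrite (sC _ _ p1 p2).
have [t [tP tU]] := shF (phi U) C' C'U covC' s' compat.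
exists t; split=> [V c h|t' t'P].
  have hV : phi V `<=` phi V by [].
  by rewrite (tP _ (C'V _ c)) (s'E _ _ _ c hV) res1.
apply: tU => Z cZ h; case: (cZ) => V cV q.
rewrite (s'E _ _ _ cV q) -(t'P V cV (CU _ cV)).
by rewrite (resC _ _ _ _ _ h).
Qed.

Definition opensI (T : topologicalType) (U V : opens T) : opens T :=
  Opens (openI (oset_open U) (oset_open V)).

Record ringed_space := RingedSpace {
  space :> topologicalType;
  OO : opens space -> comPzRingType;
  ores : forall U V : opens space, V `<=` U -> {rmorphism OO U -> OO V};
  ores_id : forall (U : opens space) (h : U `<=` U) s, ores h s = s;
  ores_comp : forall (U V W : opens space)
    (h1 : V `<=` U) (h2 : W `<=` V) (h3 : W `<=` U) s,
    ores h2 (ores h1 s) = ores h3 s;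
  ores_sheaf : is_sheaf (fun U V h => ores h : OO U -> OO V) }.

Section Restriction.
Variables (X : ringed_space) (W : opens X).

Lemma image_open_subproof (V : opens (set_type W)) :
  open ((fun x : set_type W => \val x) @` V).
Proof.
case: V => V /= [B oB <-].
rewrite (_ : _ @` _ = B `&` W); first exact: openI oB (oset_open W).
apply/seteqP; split=> [x [y By <-]|x [Bx Wx]].
  by split=> //; exact: set_valP.
by exists (SigSub (mem_set Wx)).
Qed.

Definition open_image (V : opens (set_type W)) : opens X :=
  Opens (image_open_subproof V).

Lemma open_image_mono (U V : opens (set_type W)) :
  V `<=` U -> open_image V `<=` open_image U.
Proof. by move=> VU _ [x Vx <-]; exists x => //; exact: VU. Qed.

Lemma open_image_cover (U : opens (set_type W)) (C : set (opens (set_type W))) :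
  (forall V, C V -> V `<=` U) ->
  (forall x, oset U x -> exists2 V, C V & oset V x) ->
  forall y, oset (open_image U) y -> exists2 V, C V & oset (open_image V) y.
Proof.
move=> _ cov _ [x Ux <-]; have [V cV Vx] := cov x Ux.
by exists V => //; exists x.
Qed.

Lemma open_image_cap (V1 V2 : opens (set_type W)) (Z : opens X) :
  Z `<=` open_image V1 -> Z `<=` open_image V2 ->
  exists U : opens (set_type W), [/\ U `<=` V1, U `<=` V2 & Z `<=` open_image U].
Proof.
move=> h1 h2; exists (opensI V1 V2); split=> [x []//|x []//|z Zz].
have [x1 V1x1 e1] := h1 z Zz; have [x2 V2x2 e2] := h2 z Zz.
have e : x1 = x2 by apply: val_inj; rewrite e1 e2.
by exists x1 => //; split=> //; rewrite e.
Qed.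

Definition rs_restr : ringed_space := {|
  space := set_type W;
  OO := fun V => OO (open_image V);
  ores := fun U V h => ores (open_image_mono h);
  ores_id := fun U h => ores_id (open_image_mono h);
  ores_comp := fun U V Z h1 h2 h3 =>
    ores_comp (open_image_mono h1) (open_image_mono h2) (open_image_mono h3);
  ores_sheaf := is_sheaf_comp (mono := open_image_mono) (@ores_id X) (@ores_comp X)
    open_image_cover open_image_cap (@ores_sheaf X) |}.

End Restriction.

Definition prime_ideal (A : comPzRingType) (P : set A) : Prop :=
  [/\ P 0, (forall a b, P a -> P b -> P (a + b)),
      (forall a b, P b -> P (a * b)), ~ P 1 &
      (forall a b, P (a * b) -> P a \/ P b)].

(* [B] is the localization of [A] at the powers of [f]. *)
Definition is_localization (A B : comPzRingType) (g : A -> B) (f : A) : Prop :=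
  [/\ (exists b, g f * b = 1),
      (forall b, exists a n, b * g f ^+ n = g a) &
      (forall a, g a = 0 -> exists n, f ^+ n * a = 0)].

(* The ringed space [X|W] is isomorphic to [Spec A]: [phi] restricts to a
   homeomorphism from [W] to the set of primes of [A] with its Zariski topology
   (the [D(f)], i.e. the primes not containing [f], form a basis), and the
   structure sheaf is the one whose sections on [D(f)] are the [A]-algebra
   [A_f]; this determines it since the [D(f)] form a basis. *)
Definition affine_open (X : ringed_space) (W : opens X) : Prop :=
  exists (A : comPzRingType) (rho : {rmorphism A -> OO W}) (phi : X -> set A),
    [/\ (forall x, oset W x -> prime_ideal (phi x)),
        (forall x y, oset W x -> oset W y -> phi x = phi y -> x = y),
        (forall P, prime_ideal P -> exists2 x, oset W x & phi x = P),
        (forall f : A, exists (D : opens X) (h : D `<=` W),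
          (forall x, oset D x <-> oset W x /\ ~ phi x f) /\
          is_localization (fun a => ores h (rho a)) f) &
        (forall (V : opens X) x, oset V x -> oset W x -> exists f : A,
          ~ phi x f /\ forall y, oset W y -> ~ phi y f -> oset V y)].

Record scheme := Scheme {
  scheme_space :> ringed_space;
  scheme_affine : forall x : scheme_space,
    exists2 W : opens scheme_space, oset W x & affine_open W }.

Definition opens_preim (S T : topologicalType) (f : S -> T)
    (cf : continuous f) (U : opens T) : opens S :=
  Opens (open_comp (fun x _ => cf x) (oset_open U)).

Lemma opens_preim_mono (S T : topologicalType) (f : S -> T)
    (cf : continuous f) (U V : opens T) :
  V `<=` U -> opens_preim cf V `<=` opens_preim cf U.
Proof. by move=> VU x /= /VU. Qed.
Arguments opens_preim_mono {S T f} cf {U V} _.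

(* A germ is a unit iff it is one on some neighbourhood, so [hom_local] says
   that the maps induced on stalks are local. *)
Record scheme_hom (X Y : scheme) := SchemeHom {
  hom_fun :> X -> Y;
  hom_cont : continuous hom_fun;
  hom_pull : forall U : opens Y, {rmorphism OO U -> OO (opens_preim hom_cont U)};
  hom_pull_res : forall (U V : opens Y) (h : V `<=` U) s,
    hom_pull V (ores h s) = ores (opens_preim_mono hom_cont h) (hom_pull U s);
  hom_local : forall (x : X) (U : opens Y) (s : OO U), oset U (hom_fun x) ->
    (exists (V : opens X) (h : V `<=` opens_preim hom_cont U) (t : OO V),
      oset V x /\ ores h (hom_pull U s) * t = 1) ->
    exists (V : opens Y) (h : V `<=` U) (t : OO V),
      oset V (hom_fun x) /\ ores h s * t = 1 }.
Arguments hom_cont {X Y} s : rename.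

Definition closed_immersion (X0 X : scheme) (i : scheme_hom X0 X) : Prop :=
  [/\ injective i, (forall Z : set X0, closed Z -> closed (i @` Z)) &
      (forall (U : opens X) (t : OO (opens_preim (hom_cont i) U)) x, oset U x ->
        exists (V : opens X) (h : V `<=` U) (s : OO V),
          oset V x /\ hom_pull i V s = ores (opens_preim_mono (hom_cont i) h) t)].

Definition square_zero_extension (X0 X : scheme) (i : scheme_hom X0 X) : Prop :=
  closed_immersion i /\
  forall (U : opens X) (a b : OO U),
    hom_pull i U a = 0 -> hom_pull i U b = 0 -> a * b = 0.

Record omod (X : ringed_space) := OMod {
  sec :> forall U : opens X, lmodType (OO U);
  mres : forall U V : opens X, V `<=` U -> sec U -> sec V;
  mres_add : forall (U V : opens X) (h : V `<=` U) x y,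
    mres h (x + y) = mres h x + mres h y;
  mres_scale : forall (U V : opens X) (h : V `<=` U) (a : OO U) x,
    mres h (a *: x) = ores h a *: mres h x;
  mres_id : forall (U : opens X) (h : U `<=` U) s, mres h s = s;
  mres_comp : forall (U V W : opens X)
    (h1 : V `<=` U) (h2 : W `<=` V) (h3 : W `<=` U) s,
    mres h2 (mres h1 s) = mres h3 s;
  mres_sheaf : is_sheaf (fun U V h => mres h : sec U -> sec V) }.

Lemma mres0 X (M : omod X) (U V : opens X) (h : V `<=` U) :
  mres h (0 : M U) = 0.
Proof. by apply: (addrI (mres h 0)); rewrite -mres_add !addr0. Qed.

Lemma mresN X (M : omod X) (U V : opens X) (h : V `<=` U) (x : M U) :
  mres h (- x) = - mres h x.
Proof. by apply: (addrI (mres h x)); rewrite -mres_add !subrr mres0. Qed.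

Record omod_hom X (M N : omod X) := OModHom {
  mfun :> forall U : opens X, M U -> N U;
  mfun_linear : forall U, linear (@mfun U);
  mfun_res : forall (U V : opens X) (h : V `<=` U) x,
    mfun (mres h x) = mres h (mfun x) }.
Arguments mfun {X M N} _ U _.

Section OModHomTheory.
Variables (X : ringed_space) (M N : omod X) (f : omod_hom M N) (U : opens X).

Lemma mfunD (x y : M U) : f U (x + y) = f U x + f U y.
Proof. by have := mfun_linear f 1 x y; rewrite !scale1r. Qed.

Lemma mfun0 : f U 0 = 0.
Proof. by apply: (addrI (f U 0)); rewrite -mfunD !addr0. Qed.

Lemma mfunN (x : M U) : f U (- x) = - f U x.
Proof. by apply: (addrI (f U x)); rewrite -mfunD !subrr mfun0. Qed.

Lemma mfunZ a (x : M U) : f U (a *: x) = a *: f U x.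
Proof. by have := mfun_linear f a x 0; rewrite mfun0 !addr0. Qed.

End OModHomTheory.

Section HomOperations.
Variable X : ringed_space.

Definition mid (M : omod X) : omod_hom M M.
Proof. by exists (fun U x => x). Defined.

Definition mcomp (M N P : omod X) (g : omod_hom N P) (f : omod_hom M N) :
  omod_hom M P.
Proof.
exists (fun U x => g U (f U x)) => [U a x y|U V h x].
  by rewrite !mfunD !mfunZ.
by rewrite !mfun_res.
Defined.

Definition mzero (M N : omod X) : omod_hom M N.
Proof.
exists (fun U x => 0) => [U a x y|U V h x]; first by rewrite scaler0 addr0.
by rewrite mres0.
Defined.

Definition mopp (M N : omod X) (f : omod_hom M N) : omod_hom M N.
Proof.
exists (fun U x => - f U x) => [U a x y|U V h x].
  by rewrite mfunD mfunZ opprD scalerN.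
by rewrite mfun_res mresN.
Defined.

Lemma msum_sheaf (M N : omod X) :
  is_sheaf (fun (U V : opens X) (h : V `<=` U) (x : M U * N U) =>
    (mres h x.1, mres h x.2)).
Proof.
move=> U C CU cov s sC.
have [u [uP uU]] := mres_sheaf (o := M) CU cov (s := fun V c => (s V c).1)
  (fun V1 V2 c1 c2 W h1 h2 => congr1 fst (sC V1 V2 c1 c2 W h1 h2)).
have [v [vP vU]] := mres_sheaf (o := N) CU cov (s := fun V c => (s V c).2)
  (fun V1 V2 c1 c2 W h1 h2 => congr1 snd (sC V1 V2 c1 c2 W h1 h2)).
exists (u, v); split=> [V c h|[u' v'] t'P] /=.
  by rewrite (uP V c h) (vP V c h); case: (s V c).
by rewrite (uU u') ?(vU v') // => V c h; rewrite -(t'P V c h).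
Qed.

Definition msum (M N : omod X) : omod X.
Proof.
exists (fun U => (M U * N U)%type : lmodType (OO U))
  (fun U V h x => (mres h x.1, mres h x.2)).
- by move=> U V h x y /=; rewrite !mres_add.
- by move=> U V h a x /=; rewrite !mres_scale.
- by move=> U h [x y] /=; rewrite !mres_id.
- by move=> U V W h1 h2 h3 x /=; rewrite !(mres_comp h1 h2 h3).
- exact: msum_sheaf.
Defined.

Lemma ofree_sheaf n :
  is_sheaf (fun (U V : opens X) (h : V `<=` U) (x : 'rV[OO U]_n) =>
    map_mx (ores h) x).
Proof.
move=> U C CU cov s sC.
have sj j := ores_sheaf (r := X) CU cov (s := fun V c => s V c 0 j)
  (fun V1 V2 c1 c2 W h1 h2 =>
     etrans (esym (mxE _ _ _ _)) (etrans
       (congr1 (fun A : 'rV_n => A 0 j) (sC V1 V2 c1 c2 W h1 h2))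
       (mxE _ _ _ _))).
exists (\row_j sval (cid (sj j))); split=> [V c h|t' t'P].
  apply/rowP => j; rewrite !mxE; case: (cid (sj j)) => t [tP _] /=.
  exact: tP.
apply/rowP => j; rewrite !mxE; case: (cid (sj j)) => t [_ tU] /=.
by apply: tU => V c h; rewrite -(t'P V c h) mxE.
Qed.

Definition ofree (n : nat) : omod X.
Proof.
exists (fun U => 'rV[OO U]_n : lmodType (OO U)) (fun U V h x => map_mx (ores h) x).
- by move=> U V h x y; rewrite map_mxD.
- by move=> U V h a x; rewrite map_mxZ.
- by move=> U h x; apply/rowP => j; rewrite !mxE ores_id.
- move=> U V W h1 h2 h3 x; apply/rowP => j.
  by rewrite !mxE (ores_comp h1 h2 h3).
- exact: ofree_sheaf.
Defined.

Definition summand_finite_free (M : omod X) : Prop :=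
  exists n (i : omod_hom M (ofree n)) (p : omod_hom (ofree n) M),
    mcomp p i = mid M.

End HomOperations.

Definition omod_restr (X : ringed_space) (W : opens X) (M : omod X) :
  omod (rs_restr W).
Proof.
exists (fun V => M (open_image V)) (fun U V h => mres (open_image_mono h)).
- by move=> U V h x y; rewrite mres_add.
- by move=> U V h a x; rewrite mres_scale.
- by move=> U h x; rewrite mres_id.
- by move=> U V Z h1 h2 h3 x; apply: mres_comp.
- exact: is_sheaf_comp (@mres_id X M) (@mres_comp X M)
    (@open_image_cover X W) (@open_image_cap X W) (@mres_sheaf X M).
Defined.

Definition hom_restr (X : ringed_space) (W : opens X) (M N : omod X)
  (f : omod_hom M N) : omod_hom (omod_restr W M) (omod_restr W N).
Proof.
exists (fun V => f (open_image V)) => [V a x y|U V h x].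
  exact: (mfun_linear f a x y).
exact: (mfun_res f (open_image_mono h) x).
Defined.

Definition rscal (R S : comPzRingType) (phi : {rmorphism R -> S})
  (V : lmodType S) : Type := V.

Section RestrictionOfScalars.
Variables (R S : comPzRingType) (phi : {rmorphism R -> S}) (V : lmodType S).

HB.instance Definition _ := GRing.Zmodule.on (rscal phi V).

Definition rscal_scale (a : R) (x : rscal phi V) : rscal phi V := phi a *: (x : V).

Lemma rscal_scaleA a b x : rscal_scale a (rscal_scale b x) = rscal_scale (a * b) x.
Proof. by rewrite /rscal_scale scalerA rmorphM. Qed.

Lemma rscal_scale1 : left_id 1 rscal_scale.
Proof. by move=> x; rewrite /rscal_scale rmorph1 scale1r. Qed.

Lemma rscal_scaleDr : right_distributive rscal_scale +%R.
Proof. by move=> a x y; exact: scalerDr. Qed.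

Lemma rscal_scaleDl x : {morph rscal_scale^~ x : a b / a + b}.
Proof. by move=> a b; rewrite /rscal_scale rmorphD scalerDl. Qed.

HB.instance Definition _ := GRing.Zmodule_isLmodule.Build R (rscal phi V)
  rscal_scaleA rscal_scale1 rscal_scaleDr rscal_scaleDl.

End RestrictionOfScalars.

Section Pushforward.
Variables (X Y : scheme) (f : scheme_hom X Y).

Lemma opens_preim_cover (U : opens Y) (C : set (opens Y)) :
  (forall V, C V -> V `<=` U) ->
  (forall y, oset U y -> exists2 V, C V & oset V y) ->
  forall x, oset (opens_preim (hom_cont f) U) x ->
    exists2 V, C V & oset (opens_preim (hom_cont f) V) x.
Proof. by move=> _ cov x /cov [V]; exists V. Qed.

Lemma opens_preim_cap (V1 V2 : opens Y) (Z : opens X) :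
  Z `<=` opens_preim (hom_cont f) V1 -> Z `<=` opens_preim (hom_cont f) V2 ->
  exists U : opens Y,
    [/\ U `<=` V1, U `<=` V2 & Z `<=` opens_preim (hom_cont f) U].
Proof.
move=> h1 h2; exists (opensI V1 V2).
by split=> [x []//|x []//|z Zz]; split; [exact: h1|exact: h2].
Qed.

Definition omod_push (M : omod X) : omod Y.
Proof.
exists (fun U => rscal (hom_pull f U) (M (opens_preim (hom_cont f) U))
          : lmodType (OO U))
  (fun U V h => mres (opens_preim_mono (hom_cont f) h)).
- by move=> U V h x y; exact: mres_add.
- move=> U V h a x; rewrite [LHS]mres_scale.
  by rewrite -hom_pull_res.
- by move=> U h x; exact: mres_id.
- by move=> U V W h1 h2 h3 x; exact: mres_comp.
- exact: is_sheaf_comp (@mres_id X M) (@mres_comp X M)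
    opens_preim_cover opens_preim_cap (@mres_sheaf X M).
Defined.

Definition hom_push (M N : omod X) (g : omod_hom M N) :
  omod_hom (omod_push M) (omod_push N).
Proof.
exists (fun U => g (opens_preim (hom_cont f) U)) => [U a x y|U V h x].
  exact: (mfun_linear g (hom_pull f U a) x y).
exact: (mfun_res g (opens_preim_mono (hom_cont f) h) x).
Defined.

End Pushforward.

Record cochain (X : ringed_space) := Cochain {
  cterm :> int -> omod X;
  cdiff : forall i : int, omod_hom (cterm i) (cterm (i + 1));
  cdiff_cdiff : forall i U (x : cterm i U), cdiff (i + 1) U (cdiff i U x) = 0 }.
Arguments cdiff {X} c i.
Arguments cdiff_cdiff {X} c i U x.

Record chain_map X (A B : cochain X) := ChainMap {
  cmap :> forall i : int, omod_hom (A i) (B i);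
  cmap_diff : forall i U (x : A i U),
    cdiff B i U (cmap i U x) = cmap (i + 1) U (cdiff A i U x) }.
Arguments cmap_diff {X A B} c i U x.

Section Complexes.
Variable X : ringed_space.
Implicit Types A B C : cochain X.

Definition idc A : chain_map A A.
Proof. by exists (fun i => mid (A i)). Defined.

Definition ccomp A B C (g : chain_map B C) (f : chain_map A B) : chain_map A C.
Proof.
by exists (fun i => mcomp (g i) (f i)) => i U x /=; rewrite !cmap_diff.
Defined.

Definition czero A B : chain_map A B.
Proof. by exists (fun i => mzero (A i) (B i)) => i U x /=; rewrite mfun0. Defined.

Definition copp A B (f : chain_map A B) : chain_map A B.
Proof.
by exists (fun i => mopp (f i)) => i U x /=; rewrite mfunN cmap_diff.
Defined.

Definition shift A : cochain X.
Proof.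
exists (fun i => A (i + 1)) (fun i => mopp (cdiff A (i + 1))) => i U x /=.
by rewrite mfunN opprK cdiff_cdiff.
Defined.

Definition cshift A B (f : chain_map A B) : chain_map (shift A) (shift B).
Proof.
by exists (fun i => f (i + 1)) => i U x /=; rewrite mfunN cmap_diff.
Defined.

Definition csum A B : cochain X.
Proof.
exists (fun i => msum (A i) (B i)) (fun i => OModHom
  (mfun := fun U (x : msum (A i) (B i) U) =>
     ((cdiff A i U x.1, cdiff B i U x.2) : msum (A (i + 1)) (B (i + 1)) U))
  ltac:(by move=> U a x y /=; rewrite !mfunD !mfunZ)
  ltac:(by move=> U V h x /=; rewrite !mfun_res)) => i U x /=.
by rewrite !cdiff_cdiff.
Defined.

Definition csum_map A B A' B' (f : chain_map A A') (g : chain_map B B') :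
  chain_map (csum A B) (csum A' B').
Proof.
exists (fun i => OModHom
  (mfun := fun U (x : msum (A i) (B i) U) =>
     ((f i U x.1, g i U x.2) : msum (A' i) (B' i) U))
  ltac:(by move=> U a x y /=; rewrite !mfunD !mfunZ)
  ltac:(by move=> U V h x /=; rewrite !mfun_res)) => i U x /=.
by rewrite !cmap_diff.
Defined.

Definition cdiag A : chain_map A (csum A A).
Proof.
by exists (fun i => OModHom
  (mfun := fun U (x : A i U) => ((x, x) : msum (A i) (A i) U))
  ltac:(by []) ltac:(by [])).
Defined.

Definition ccodiag A : chain_map (csum A A) A.
Proof.
exists (fun i => OModHom
  (mfun := fun U (x : msum (A i) (A i) U) => x.1 + x.2)
  ltac:(by move=> U a x y /=; rewrite scalerDr addrACA)
  ltac:(by move=> U V h x /=; rewrite mres_add)) => i U x /=.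
by rewrite mfunD.
Defined.

(* The mapping cone: in degree i it is A^(i+1) + B^i, with differential
   (a, b) |-> (- d a, f a + d b). *)
Definition cone A B (f : chain_map A B) : cochain X.
Proof.
exists (fun i => msum (A (i + 1)) (B i)) (fun i => OModHom
  (mfun := fun U (x : msum (A (i + 1)) (B i) U) =>
     ((- cdiff A (i + 1) U x.1, f (i + 1) U x.1 + cdiff B i U x.2)
       : msum (A (i + 1 + 1)) (B (i + 1)) U))
  ltac:(by move=> U a x y; congr (_, _); rewrite /= !mfunD !mfunZ;
    rewrite ?opprD ?scalerN ?scalerDr // addrACA)
  ltac:(by move=> U V h x /=; rewrite !mfun_res mres_add mresN)) => i U x /=.
by rewrite mfunN opprK cdiff_cdiff mfunN mfunD cmap_diff cdiff_cdiff addr0 addNr.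
Defined.

Definition cone_in A B (f : chain_map A B) : chain_map B (cone f).
Proof.
exists (fun i => OModHom
  (mfun := fun U (x : B i U) => ((0, x) : msum (A (i + 1)) (B i) U))
  ltac:(by move=> U a x y; congr (_, _); rewrite /= scaler0 addr0)
  ltac:(by move=> U V h x /=; rewrite mres0)) => i U x /=.
by rewrite !mfun0 oppr0 add0r.
Defined.

Definition cone_out A B (f : chain_map A B) : chain_map (cone f) (shift A).
Proof.
by exists (fun i => OModHom
  (mfun := fun U (x : msum (A (i + 1)) (B i) U) => x.1)
  ltac:(by []) ltac:(by [])).
Defined.

Definition locally_on (U : opens X)
    (P : forall V : opens X, V `<=` U -> Prop) : Prop :=
  forall x, oset U x -> exists (V : opens X) (h : V `<=` U), oset V x /\ P V h.

Definition locally_exact A i (U : opens X) (a : A (i + 1) U) : Prop :=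
  locally_on (fun (V : opens X) (h : V `<=` U) =>
    exists b : A i V, cdiff A i V b = mres h a).

(* [f] induces isomorphisms on the cohomology sheaves: a section of the
   cohomology sheaf in degree i + 1 is locally the class of a cocycle, which
   vanishes iff the cocycle is locally a coboundary. The two clauses are
   injectivity and (local) surjectivity. *)
Definition quasi_iso A B (f : chain_map A B) : Prop :=
  forall i (U : opens X),
    (forall a : A (i + 1) U, cdiff A (i + 1) U a = 0 ->
       locally_exact (f (i + 1) U a) -> locally_exact a) /\
    (forall b : B (i + 1) U, cdiff B (i + 1) U b = 0 ->
       locally_on (fun (V : opens X) (h : V `<=` U) =>
         exists2 a : A (i + 1) V, cdiff A (i + 1) V a = 0 &
           locally_exact (f (i + 1) V a - mres h b))).

Definition strictly_perfect A : Prop :=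
  (exists n : nat, forall i : int, (n < `|i|)%N ->
     forall U (x : A i U), x = 0) /\
  (forall i, summand_finite_free (A i)).

End Complexes.

Definition cochain_restr (X : ringed_space) (W : opens X) (A : cochain X) :
  cochain (rs_restr W).
Proof.
exists (fun i => omod_restr W (A i)) (fun i => hom_restr W (cdiff A i)) => i U x /=.
exact: cdiff_cdiff.
Defined.

Definition perfect (X : ringed_space) (A : cochain X) : Prop :=
  forall x : X, exists (W : opens X) (P : cochain (rs_restr W)),
    [/\ oset W x, strictly_perfect P &
        exists s : chain_map P (cochain_restr W A), quasi_iso s].

(* Pushforward along a closed immersion is exact, so there the termwise
   pushforward computes the derived one. *)
Definition pushforward (X Y : scheme) (f : scheme_hom X Y) (A : cochain X) :
  cochain Y.
Proof.
exists (fun i => omod_push f (A i)) (fun i => hom_push f (cdiff A i)) => i U x /=.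
exact: cdiff_cdiff.
Defined.

Section QuasiIsomorphisms.
Variable X : ringed_space.
Implicit Types A B : cochain X.

Lemma locally_on_sub (U : opens X) (P Q : forall V : opens X, V `<=` U -> Prop) :
  (forall V h, P V h -> Q V h) -> locally_on P -> locally_on Q.
Proof.
by move=> PQ lP x /lP [V [h [Vx PV]]]; exists V, h; split=> //; exact: PQ.
Qed.

Lemma locally_exact_shift A i (U : opens X) (a : A (i + 1 + 1) U) :
  @locally_exact X (shift A) i U a <-> locally_exact a.
Proof.
split; apply: locally_on_sub => V h [b e]; exists (- b).
  by rewrite mfunN.
by rewrite /= mfunN opprK.
Qed.

Lemma cshift_quasi_iso A B (f : chain_map A B) :
  quasi_iso f -> quasi_iso (cshift f).
Proof.
move=> qf i U; have [inj sur] := qf (i + 1) U; split.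
  move=> a /= /eqP; rewrite oppr_eq0 => /eqP da /locally_exact_shift fa.
  by apply/locally_exact_shift; exact: inj.
move=> b /= /eqP; rewrite oppr_eq0 => /eqP /sur.
apply: locally_on_sub => V h [a da e]; exists a; first by rewrite da oppr0.
exact/locally_exact_shift.
Qed.

Lemma locally_exact_sum A B i (U : opens X) (x : csum A B (i + 1) U) :
  locally_exact x <-> locally_exact (x.1 : A (i + 1) U) /\
                      locally_exact (x.2 : B (i + 1) U).
Proof.
split=> [lx|[l1 l2] y Uy].
  split; move: lx; apply: locally_on_sub => V h [[b1 b2] /= e].
    by exists b1; case: e.
  by exists b2; case: e.
have [V1 [h1 [V1y [b1 e1]]]] := l1 y Uy.
have [V2 [h2 [V2y [b2 e2]]]] := l2 y Uy.
have k1 : opensI V1 V2 `<=` V1 by move=> z [].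
have k2 : opensI V1 V2 `<=` V2 by move=> z [].
have k : opensI V1 V2 `<=` U := subset_trans k1 h1.
exists (opensI V1 V2), k; split; first by split.
exists ((mres k1 b1, mres k2 b2) : csum A B i (opensI V1 V2)).
rewrite /= !mfun_res e1 e2.
by rewrite (mres_comp h1 k1 k) (mres_comp h2 k2 k).
Qed.

Lemma locally_exact_res A i (U V : opens X) (h : V `<=` U) (a : A (i + 1) U) :
  locally_exact a -> locally_exact (mres h a).
Proof.
move=> la x Vx; have [W [k [Wx [b e]]]] := la x (h x Vx).
have k1 : opensI W V `<=` W by move=> z [].
have k2 : opensI W V `<=` V by move=> z [].
exists (opensI W V), k2; split; first by split.
exists (mres k1 b); rewrite mfun_res e.
by rewrite (mres_comp h k2 (subset_trans k2 h)) (mres_comp k k1 (subset_trans k2 h)).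
Qed.

Lemma csum_quasi_iso A B A' B' (f : chain_map A A') (g : chain_map B B') :
  quasi_iso f -> quasi_iso g -> quasi_iso (csum_map f g).
Proof.
move=> qf qg i U; have [fi fs] := qf i U; have [gi gs] := qg i U; split.
  case=> a1 a2 /= [da1 da2] /locally_exact_sum [/= l1 l2].
  by apply/locally_exact_sum; split; [exact: fi|exact: gi].
case=> b1 b2 /= [db1 db2] y Uy.
have [V1 [h1 [V1y [a1 d1 e1]]]] := fs b1 db1 y Uy.
have [V2 [h2 [V2y [a2 d2 e2]]]] := gs b2 db2 y Uy.
have k1 : opensI V1 V2 `<=` V1 by move=> z [].
have k2 : opensI V1 V2 `<=` V2 by move=> z [].
have k : opensI V1 V2 `<=` U := subset_trans k1 h1.
exists (opensI V1 V2), k; split; first by split.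
exists ((mres k1 a1, mres k2 a2) : csum A B (i + 1) (opensI V1 V2)).
  by rewrite /= !mfun_res d1 d2 !mres0.
apply/locally_exact_sum; split=> /=.
  move: (locally_exact_res k1 e1).
  by rewrite mres_add mresN mfun_res (mres_comp h1 k1 k).
move: (locally_exact_res k2 e2).
by rewrite mres_add mresN mfun_res (mres_comp h2 k2 k).
Qed.

End QuasiIsomorphisms.

(* D(X) is the localization of the category of complexes at the
   quasi-isomorphisms (Gabriel-Zisman), presented by generators and relations:
   its morphisms are the terms of [dhom] modulo the congruence [deq]. *)
Inductive dhom (X : ringed_space) : cochain X -> cochain X -> Type :=
| DMap A B (f : chain_map A B) : dhom A B
| DInv A B (s : chain_map A B) (qs : quasi_iso s) : dhom B A
| DComp A B C (g : dhom B C) (f : dhom A B) : dhom A C.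

Inductive deq (X : ringed_space) :
    forall A B : cochain X, dhom A B -> dhom A B -> Prop :=
| deq_refl A B (f : dhom A B) : deq f f
| deq_sym A B (f g : dhom A B) : deq f g -> deq g f
| deq_trans A B (f g h : dhom A B) : deq f g -> deq g h -> deq f h
| deq_comp A B C (g g' : dhom B C) (f f' : dhom A B) :
    deq g g' -> deq f f' -> deq (DComp g f) (DComp g' f')
| deq_assoc A B C D (h : dhom C D) (g : dhom B C) (f : dhom A B) :
    deq (DComp h (DComp g f)) (DComp (DComp h g) f)
| deq_idl A B (f : dhom A B) : deq (DComp (DMap (idc B)) f) f
| deq_idr A B (f : dhom A B) : deq (DComp f (DMap (idc A))) f
| deq_map A B C (g : chain_map B C) (f : chain_map A B) :
    deq (DMap (ccomp g f)) (DComp (DMap g) (DMap f))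
| deq_invl A B (s : chain_map A B) (qs : quasi_iso s) :
    deq (DComp (DInv qs) (DMap s)) (DMap (idc A))
| deq_invr A B (s : chain_map A B) (qs : quasi_iso s) :
    deq (DComp (DMap s) (DInv qs)) (DMap (idc B)).

Declare Scope derived_scope.
Delimit Scope derived_scope with D.
Notation "f =D g" := (deq f g) (at level 70, no associativity) : derived_scope.
Notation "g \o f" := (DComp g f) : derived_scope.
Local Open Scope derived_scope.

Section DerivedCategory.
Variable X : ringed_space.
Implicit Types A B C : cochain X.

Definition diso A B (f : dhom A B) : Prop :=
  exists g : dhom B A, g \o f =D DMap (idc A) /\ f \o g =D DMap (idc B).

Definition dzero A B : dhom A B := DMap (czero A B).

Fixpoint dshift A B (f : dhom A B) : dhom (shift A) (shift B) :=
  match f with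
  | DMap _ _ f => DMap (cshift f)
  | DInv _ _ s qs => DInv (cshift_quasi_iso qs)
  | DComp _ _ _ g f => dshift g \o dshift f
  end.

Lemma idc_quasi_iso A : quasi_iso (idc A).
Proof.
move=> i U; split=> // b db x Ux; exists U, (fun x h => h); split=> //.
exists b => //; rewrite /= mres_id subrr => y Uy.
by exists U, (fun x h => h); split=> //; exists 0; rewrite mfun0 mres0.
Qed.

Fixpoint dsuml C A B (f : dhom A B) : dhom (csum A C) (csum B C) :=
  match f with
  | DMap _ _ f => DMap (csum_map f (idc C))
  | DInv _ _ s qs => DInv (csum_quasi_iso qs (idc_quasi_iso C))
  | DComp _ _ _ g f => dsuml C g \o dsuml C f
  end.

Fixpoint dsumr C A B (f : dhom A B) : dhom (csum C A) (csum C B) :=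
  match f with
  | DMap _ _ f => DMap (csum_map (idc C) f)
  | DInv _ _ s qs => DInv (csum_quasi_iso (idc_quasi_iso C) qs)
  | DComp _ _ _ g f => dsumr C g \o dsumr C f
  end.

(* The addition of D(X) as an additive category: A -> A + A -> B + B -> B *)
Definition dadd A B (f g : dhom A B) : dhom A B :=
  DMap (ccodiag B) \o (dsumr B g \o (dsuml A f \o DMap (cdiag A))).

Definition dopp A B (f : dhom A B) : dhom A B := DMap (copp (idc B)) \o f.

Definition dsub A B (f g : dhom A B) : dhom A B := dadd f (dopp g).

Definition Ext1 A B : Type := dhom A (shift B).

(* Isomorphic in D(X) to the triangle A -> B -> cone f -> A[1] of a map of
   complexes f. *)
Definition exact_triangle A B C
    (u : dhom A B) (v : dhom B C) (w : dhom C (shift A)) : Prop :=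
  exists A' B' (f : chain_map A' B')
      (al : dhom A A') (be : dhom B B') (ga : dhom C (cone f)),
    [/\ diso al, diso be & diso ga] /\
    [/\ be \o u =D DMap f \o al,
        ga \o v =D DMap (cone_in f) \o be &
        dshift al \o w =D DMap (cone_out f) \o ga].

End DerivedCategory.
Notation "f - g" := (dsub f g) : derived_scope.

(* Main.v *)
From Stdlib Require Import Setoid Morphisms.
From mathcomp Require Import all_boot all_algebra.
From mathcomp Require Import boolp classical_sets.
Require Import Defs.

(* The obstruction is o = c' la - f[1] c. As D(X) is additive, o vanishes iff
   the right-hand square (la, f[1]) commutes, and then the missing map E -> F
   exists by the completion axiom for morphisms of triangles. Both facts are
   derived from a calculus of right fractions: morphisms of D(X) are roofs, and
   two maps of complexes agree in D(X) iff they become homotopic after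
   precomposition with a quasi-isomorphism. The latter is read off an action of
   the words presenting D(X) on roofs with fixed target, which respects all the
   relations. For the completion, a commutative square over the connecting maps
   cone u -> A[1] is replaced by a square of complexes commuting up to homotopy;
   homotopy fibers are functorial for such squares, and the fiber of
   cone u -> A[1] is B up to quasi-isomorphism. *)

Set Implicit Arguments.
Unset Strict Implicit.
Unset Printing Implicit Defensive.

Import GRing.Theory.

(** * Complexes, shifts and homotopies *)

Section ChainMaps.
Local Open Scope classical_set_scope.
Local Open Scope ring_scope.
Variable X : ringed_space.
Implicit Types A B C Q : cochain X.

Lemma omod_hom_ext (M N : omod X) (f g : omod_hom M N) :
  (forall U x, f U x = g U x) -> f = g.
Proof.
case: f g => f fl fr [g gl gr] /= e.
have ? : f = g by apply: functional_extensionality_dep => U; apply/funext => x.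
by subst g; congr OModHom; exact: Prop_irrelevance.
Qed.

Lemma chain_map_ext A B (f g : chain_map A B) :
  (forall i U x, f i U x = g i U x) -> f = g.
Proof.
case: f g => f fd [g gd] /= e.
have ? : f = g.
  by apply: functional_extensionality_dep => i; exact: omod_hom_ext.
by subst g; congr ChainMap; exact: Prop_irrelevance.
Qed.

(* Complexes are only given with maps from degree i to degree i + 1; this passes
   from families indexed by the degrees i + 1 to families over all degrees. *)
Lemma int_descend (P : int -> Type) (F : forall i : int, P (i + 1)) :
  exists G : forall j, P j, forall i : int, G (i + 1) = F i.
Proof.
exists (fun j => eq_rect _ P (F (j - 1)) j (subrK 1 j)) => i.
move: (i + 1 - 1) (subrK 1 (i + 1)) => k e.
have ki : k = i by apply: (@addIr _ 1); exact: e.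
by subst k; rewrite (Prop_irrelevance e erefl).
Qed.

Lemma int_pred_ind (P : int -> Prop) : (forall i : int, P (i + 1)) -> forall j, P j.
Proof. by move=> h j; rewrite -(subrK 1 j). Qed.

Definition degree_cast A (i j : int) (e : i = j) : omod_hom (A i) (A j) :=
  eq_rect i (fun k => omod_hom (A i) (A k)) (mid (A i)) j e.

Lemma degree_cast_id A i (e : i = i) U (x : A i U) : degree_cast A e U x = x.
Proof. by rewrite (Prop_irrelevance e erefl). Qed.

Lemma degree_cast_comp A i j k (e : i = j) (e' : j = k) (e'' : i = k) U
  (x : A i U) : degree_cast A e' U (degree_cast A e U x) = degree_cast A e'' U x.
Proof. by subst j k; rewrite !degree_cast_id. Qed.

Lemma degree_cast_diff A i j (e : i = j) (e' : i + 1 = j + 1) U (x : A i U) :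
  cdiff A j U (degree_cast A e U x) = degree_cast A e' U (cdiff A i U x).
Proof. by subst j; rewrite !degree_cast_id. Qed.

Lemma addr_subrC1 (j : int) : j - 1 + 1 = j + 1 - 1.
Proof. by rewrite subrK addrK. Qed.

(** The complex [A[-1]]. As [j - 1 + 1] and [j + 1 - 1] are not convertible, its differential
    carries a transport, and its shift is only isomorphic to [A]. *)
Definition unshift A : cochain X.
Proof.
exists (fun j => A (j - 1)) (fun j => mopp (mcomp
  (degree_cast A (addr_subrC1 j)) (cdiff A (j - 1)))) => j U x.
rewrite /= mfunN mfunN opprK degree_cast_diff ?subrK ?addrK // => e.
by rewrite cdiff_cdiff !mfun0.
Defined.

Definition shift_unshift A : chain_map (shift (unshift A)) A.
Proof.
exists (fun i => degree_cast A (addrK 1 i)) => i U x.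
rewrite /= opprK degree_cast_diff ?addrK // => e.
by rewrite (degree_cast_comp _ _ e).
Defined.

Definition unshift_shift A : chain_map A (shift (unshift A)).
Proof.
exists (fun i => degree_cast A (esym (addrK 1 i))) => i U x.
rewrite /= opprK degree_cast_diff ?addrK // => e.
by rewrite (degree_cast_comp _ _ (esym (addrK 1 (i + 1)))).
Defined.

Lemma unshift_shiftK A : ccomp (shift_unshift A) (unshift_shift A) = idc A.
Proof.
apply: chain_map_ext => i U x /=.
by rewrite (degree_cast_comp _ _ erefl) degree_cast_id.
Qed.

Lemma shift_unshiftK A : ccomp (unshift_shift A) (shift_unshift A) = idc _.
Proof.
apply: chain_map_ext => i U x /=.
by rewrite (degree_cast_comp _ _ erefl) degree_cast_id.
Qed.

Lemma cshift_full A B (g : chain_map (shift A) (shift B)) :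
  exists f : chain_map A B, g = cshift f.
Proof.
have [f fE] := @int_descend (fun j => omod_hom (A j) (B j)) g.
have fd j U (x : A j U) : cdiff B j U (f j U x) = f (j + 1) U (cdiff A j U x).
  elim/int_pred_ind: j x => i x; rewrite !fE; apply: oppr_inj.
  by have := cmap_diff g i U x; rewrite /= mfunN.
exists (ChainMap fd); apply: chain_map_ext => i U x.
by rewrite /= fE.
Qed.

(* Stated in degrees i + 1 only, which avoids transports along i - 1 + 1 = i. *)
Definition homotopic A B (u v : chain_map A B) : Prop :=
  exists h : forall i, omod_hom (A (i + 1)) (B i),
    forall i U (x : A (i + 1) U),
      u (i + 1) U x - v (i + 1) U x =
      cdiff B i U (h i U x) + h (i + 1) U (cdiff A (i + 1) U x).

Lemma homotopic_refl A B (u : chain_map A B) : homotopic u u.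
Proof. by exists (fun i => mzero _ _) => i U x /=; rewrite subrr mfun0 addr0. Qed.

Lemma homotopic_sym A B (u v : chain_map A B) : homotopic u v -> homotopic v u.
Proof.
case=> h hE; exists (fun i => mopp (h i)) => i U x /=.
by rewrite mfunN -opprD -hE opprB.
Qed.

Definition madd (M N : omod X) (f g : omod_hom M N) : omod_hom M N.
Proof.
exists (fun U x => f U x + g U x) => [U a x y|U V h x].
  by rewrite !mfunD !mfunZ scalerDr addrACA.
by rewrite !mfun_res mres_add.
Defined.

Lemma homotopic_trans A B (u v w : chain_map A B) :
  homotopic u v -> homotopic v w -> homotopic u w.
Proof.
case=> h hE [k kE]; exists (fun i => madd (h i) (k i)) => i U x /=.
by rewrite mfunD addrACA -hE -kE addrA subrK.
Qed.

Lemma homotopic_compl A B C (g : chain_map B C) (u v : chain_map A B) :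
  homotopic u v -> homotopic (ccomp g u) (ccomp g v).
Proof.
case=> h hE; exists (fun i => mcomp (g i) (h i)) => i U x /=.
by rewrite cmap_diff -mfunN -!mfunD hE.
Qed.

Lemma homotopic_compr A B C (u v : chain_map B C) (f : chain_map A B) :
  homotopic u v -> homotopic (ccomp u f) (ccomp v f).
Proof.
case=> h hE; exists (fun i => mcomp (h i) (f (i + 1))) => i U x /=.
by rewrite -cmap_diff hE.
Qed.

Lemma homotopic_unshift A B (u v : chain_map A B) :
  homotopic (cshift u) (cshift v) -> homotopic u v.
Proof.
case=> h hE.
have [k kE] := @int_descend (fun i => omod_hom (A (i + 1)) (B i))
  (fun i => mopp (h i)).
exists k; apply: int_pred_ind => i U x; rewrite !kE.
by have := hE i U x; rewrite /= !mfunN.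
Qed.

Lemma ccompA A B C Q (f : chain_map C Q) (g : chain_map B C) (h : chain_map A B) :
  ccomp f (ccomp g h) = ccomp (ccomp f g) h.
Proof. exact: chain_map_ext. Qed.

Lemma ccomp_idl A B (f : chain_map A B) : ccomp (idc B) f = f.
Proof. exact: chain_map_ext. Qed.

Lemma ccomp_idr A B (f : chain_map A B) : ccomp f (idc A) = f.
Proof. exact: chain_map_ext. Qed.

End ChainMaps.

(** * Quasi-isomorphisms *)

Section QuasiIso.
Local Open Scope classical_set_scope.
Local Open Scope ring_scope.
Variable X : ringed_space.
Implicit Types A B C Q : cochain X.

Lemma locally_on_bind (U : opens X) (P Q : forall V : opens X, V `<=` U -> Prop) :
  locally_on P ->
  (forall (V : opens X) (h : V `<=` U), P V h ->
     locally_on (fun (W : opens X) (k : W `<=` V) => Q W (subset_trans k h))) ->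
  locally_on Q.
Proof.
move=> lP PQ x Ux; have [V [h [Vx PV]]] := lP x Ux.
have [W [k [Wx QW]]] := PQ V h PV x Vx.
by exists W, (subset_trans k h).
Qed.

Lemma locally_on_all (U : opens X) (P : forall V : opens X, V `<=` U -> Prop) :
  (forall V h, P V h) -> locally_on P.
Proof. by move=> PV x Ux; exists U, (fun y Uy => Uy). Qed.

Lemma locally_exact_diff A i (U : opens X) (b : A i U) :
  locally_exact (cdiff A i U b).
Proof. by apply: locally_on_all => V h; exists (mres h b); rewrite mfun_res. Qed.

Lemma locally_exactD A i (U : opens X) (a b : A (i + 1) U) :
  locally_exact a -> locally_exact b -> locally_exact (a + b).
Proof.
move=> la lb; apply: (locally_on_bind la) => V h [a' ea].
have := locally_exact_res h lb; apply: locally_on_sub => W k [b' eb].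
exists (mres k a' + b'); rewrite mfunD mfun_res ea eb -mres_add.
by rewrite -mres_add (mres_comp h k (subset_trans k h)).
Qed.

Lemma locally_exactN A i (U : opens X) (a : A (i + 1) U) :
  locally_exact a -> locally_exact (- a).
Proof. by apply: locally_on_sub => V h [b e]; exists (- b); rewrite mfunN e mresN. Qed.

Lemma locally_exact_map A B (f : chain_map A B) i (U : opens X) (a : A (i + 1) U) :
  locally_exact a -> locally_exact (f (i + 1) U a).
Proof.
apply: locally_on_sub => V h [b e]; exists (f i V b).
by rewrite cmap_diff e mfun_res.
Qed.

Lemma quasi_iso_comp A B C (g : chain_map B C) (f : chain_map A B) :
  quasi_iso f -> quasi_iso g -> quasi_iso (ccomp g f).
Proof.
move=> qf qg i U; split=> [a da|c dc].
  move=> gfa; apply: (qf i U).1 => //; apply: (qg i U).1 => //.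
  by rewrite cmap_diff da mfun0.
apply: (locally_on_bind ((qg i U).2 c dc)) => V h [b db eb].
apply: locally_on_sub ((qf i V).2 b db) => W k [a da ea]; exists a => //=.
have := locally_exactD (locally_exact_map g ea) (locally_exact_res k eb).
rewrite mfunD mfunN mres_add mresN -!mfun_res (mres_comp h k (subset_trans k h)).
by rewrite addrA subrK.
Qed.

(** Part of two-out-of-three. To lift a cocycle [b], lift [g b] through [g f]; injectivity of [g] on
    cohomology then compares [f a] with [b]. *)
Lemma quasi_iso_cancel A B C (g : chain_map B C) (f : chain_map A B) :
  quasi_iso g -> quasi_iso (ccomp g f) -> quasi_iso f.
Proof.
move=> qg qgf i U; split=> [a da fa|b db].
  by apply: (qgf i U).1 => //; exact: (locally_exact_map g).
have dgb : cdiff C (i + 1) U (g (i + 1) U b) = 0 by rewrite cmap_diff db mfun0.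
apply: locally_on_sub ((qgf i U).2 _ dgb) => V h [a da ea]; exists a => //.
apply: (qg i V).1.
  by rewrite mfunD mfunN mfun_res db mres0 subr0 cmap_diff da mfun0.
by rewrite mfunD mfunN mfun_res.
Qed.

Lemma homotopic_locally_exact A B (u v : chain_map A B) i (U : opens X)
    (a : A (i + 1) U) :
  homotopic u v -> cdiff A (i + 1) U a = 0 ->
  locally_exact (u (i + 1) U a - v (i + 1) U a).
Proof.
by case=> h hE da; rewrite hE da mfun0 addr0; exact: locally_exact_diff.
Qed.

Lemma homotopic_quasi_iso A B (u v : chain_map A B) :
  homotopic u v -> quasi_iso u -> quasi_iso v.
Proof.
move=> uv qu i U; split=> [a da va|b db].
  apply: (qu i U).1 => //.
  by rewrite -[X in locally_exact X](subrK (v (i + 1) U a)); apply: locally_exactD => //;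
    exact: homotopic_locally_exact.
apply: locally_on_sub ((qu i U).2 _ db) => V h [a da ea]; exists a => //.
have := locally_exactD ea (homotopic_locally_exact (homotopic_sym uv) da).
by rewrite addrC addrA subrK.
Qed.

Lemma retract_quasi_iso A B (p : chain_map A B) (s : chain_map B A) :
  ccomp p s = idc B ->
  (forall i (U : opens X) (a : A (i + 1) U), cdiff A (i + 1) U a = 0 ->
     locally_exact (p (i + 1) U a) -> locally_exact a) ->
  quasi_iso p.
Proof.
move=> ps pinj i U; split=> [|b db]; first exact: pinj.
apply: locally_on_all => V h; exists (s (i + 1) V (mres h b)).
  by rewrite cmap_diff mfun_res db mres0 mfun0.
rewrite (_ : p _ _ _ = mres h b) ?subrr; last first.
  by have /(congr1 (fun f : chain_map B B => f (i + 1) V (mres h b))) := ps.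
by rewrite -(mfun0 (cdiff B i) V); exact: locally_exact_diff.
Qed.

(** The hypothesis speaks of the degrees [i + 1 + 1] of [f], one successor more than the conclusion;
    every degree being a successor, these are all degrees. *)
Lemma unshift_quasi_iso A B (f : chain_map A B) :
  quasi_iso (cshift f) -> quasi_iso f.
Proof.
move=> qf; apply: (@int_pred_ind (fun i => forall U,
    (forall a : A (i + 1) U, cdiff A (i + 1) U a = 0 ->
       locally_exact (f (i + 1) U a) -> locally_exact a) /\
    (forall b : B (i + 1) U, cdiff B (i + 1) U b = 0 ->
       locally_on (fun (V : opens X) (h : V `<=` U) =>
         exists2 a : A (i + 1) V, cdiff A (i + 1) V a = 0 &
           locally_exact (f (i + 1) V a - mres h b))))) => i U.
have [inj sur] := qf i U; split=> [a da fa|b db].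
  apply/locally_exact_shift; apply: inj; first by rewrite /= da oppr0.
  exact/locally_exact_shift.
have := sur b; rewrite /= db oppr0 => /(_ erefl); apply: locally_on_sub => V h [a da fa].
by exists a; [apply: oppr_inj; rewrite oppr0|exact/locally_exact_shift].
Qed.

Definition acyclic A : Prop :=
  forall i (U : opens X) (a : A (i + 1) U), cdiff A (i + 1) U a = 0 -> locally_exact a.

Lemma acyclic_unshift A : acyclic (shift A) -> acyclic A.
Proof.
move=> ac; apply: (@int_pred_ind (fun i => forall U (a : A (i + 1) U),
  cdiff A (i + 1) U a = 0 -> locally_exact a)) => i U a da.
by apply/locally_exact_shift; apply: ac; rewrite /= da oppr0.
Qed.

Lemma acyclic_retract A B (p : chain_map A B) (s : chain_map B A) :
  ccomp p s = idc B -> acyclic A -> acyclic B.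
Proof.
move=> ps ac i U b db; have /(congr1 (fun f : chain_map B B => f (i + 1) U b)) := ps.
move=> /= <-; apply: locally_exact_map; apply: ac.
by rewrite cmap_diff db mfun0.
Qed.

Lemma subr_subD (V : zmodType) (p q r : V) : p - q - (p - (q + r)) = r.
Proof. by rewrite opprB addrC addrA subrK addrC addKr. Qed.

(** For a cocycle [(a, b)], [f a = - d b], so locally [a = d a0] by injectivity on cohomology. Then
    [f a0 + b] is a cocycle, locally [f a1 - d y] by surjectivity, and [(a, b)] is the differential
    of [(a1 - a0, - y)]. *)
Lemma quasi_iso_cone A B (f : chain_map A B) : quasi_iso f -> acyclic (cone f).
Proof.
move=> qf i U [a b] /= [] /eqP; rewrite oppr_eq0 => /eqP da e.
have fa : locally_exact (f (i + 1 + 1) U a).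
  rewrite -[f _ _ _](addrK (cdiff B (i + 1) U b)) e sub0r.
  exact/locally_exactN/locally_exact_diff.
apply: (locally_on_bind ((qf (i + 1) U).1 a da fa)) => V h [a0 ea0].
have db' : cdiff B (i + 1) V (f (i + 1) V a0 + mres h b) = 0.
  by rewrite mfunD cmap_diff ea0 !mfun_res -mres_add e mres0.
apply: (locally_on_bind ((qf i V).2 _ db')) => W k [a1 da1 le].
apply: locally_on_sub le => Z l [y ey].
have kl := subset_trans l k.
exists ((mres l a1 - mres kl a0, - y) : cone f i Z); congr (_, _).
  rewrite mfunD mfunN !mfun_res da1 mres0 sub0r opprK ea0.
  by rewrite (mres_comp h kl (subset_trans (subset_trans l k) h)).
rewrite mfunN ey mfunD mfunN !mfun_res !mres_add mresN mres_add.
rewrite (mres_comp k l kl) (mres_comp h k (subset_trans k h)).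
rewrite (mres_comp (subset_trans k h) l (subset_trans (subset_trans l k) h)).
exact: subr_subD.
Qed.

(** Injectivity comes from the cocycle [(a, - b)] when [f a = d b], surjectivity from the cocycle
    [(0, b)]. *)
Lemma cone_quasi_iso A B (f : chain_map A B) : acyclic (cone f) -> quasi_iso f.
Proof.
move=> ac i U; split=> [a da|b db].
  (* The cone has [A^(i+1)] in degree [i], so [a] needs a degree [i + 1 + 1] to enter a cone cocycle
     of degree [i + 1]. *)
  elim/(@int_pred_ind): i a da => i a da fa.
  apply: (locally_on_bind fa) => V h [b eb].
  have dx : cdiff (cone f) (i + 1) V (mres h a, - b) = 0.
    by rewrite /= mfun_res da mres0 oppr0 mfunN eb mfun_res subrr.
  apply: locally_on_sub (ac _ _ _ dx) => W k [[x y] /= [ex _]].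
  by exists (- x); rewrite mfunN ex (mres_comp h k (subset_trans k h)).
have dx : cdiff (cone f) (i + 1) U (0, b) = 0 by rewrite /= db !mfun0 addr0 oppr0.
apply: locally_on_sub (ac _ _ _ dx) => V h [[x y] /= []].
rewrite mres0 => /eqP; rewrite oppr_eq0 => /eqP dx0 e.
exists x => //; rewrite -e opprD addrA subrr sub0r.
exact/locally_exactN/locally_exact_diff.
Qed.

End QuasiIso.

(** * Homotopy fibers and right fractions *)

Section Fractions.
Local Open Scope classical_set_scope.
Local Open Scope ring_scope.
Variable X : ringed_space.
Implicit Types A B C Q : cochain X.

(* The cone of w shifted by -1; as w takes values in A[1], no negative shift (hence
   no transport between degrees) is needed to write it down. *)
Definition fiber A C (w : chain_map C (shift A)) : cochain X.
Proof.
exists (fun i => msum (A i) (C i)) (fun i => OModHom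
  (mfun := fun U (x : msum (A i) (C i) U) =>
     ((cdiff A i U x.1 - w i U x.2, cdiff C i U x.2)
       : msum (A (i + 1)) (C (i + 1)) U))
  ltac:(by move=> U a x y; congr (_, _); rewrite /= !mfunD !mfunZ;
    rewrite ?opprD ?scalerBr // addrACA)
  ltac:(by move=> U V h x /=; rewrite !mfun_res mres_add mresN)) => i U x /=.
by rewrite mfunD mfunN !cdiff_cdiff add0r -(cmap_diff w) /= subrr.
Defined.

Definition fiber_in A C (w : chain_map C (shift A)) : chain_map A (fiber w).
Proof.
exists (fun i => OModHom
  (mfun := fun U (x : A i U) => ((x, 0) : msum (A i) (C i) U))
  ltac:(by move=> U a x y; congr (_, _); rewrite /= scaler0 addr0)
  ltac:(by move=> U V h x /=; rewrite mres0)) => i U x /=.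
by rewrite !mfun0 subr0.
Defined.

Definition fiber_out A C (w : chain_map C (shift A)) : chain_map (fiber w) C.
Proof.
by exists (fun i => OModHom
  (mfun := fun U (x : msum (A i) (C i) U) => x.2)
  ltac:(by []) ltac:(by [])).
Defined.

(** If [(a, c)] is a cocycle and [c = d c0] locally, then [a + w c0] is a cocycle, hence locally
    [d a1], and [(a, c) = d (a1, c0)]. A cocycle [c] lifts to [(a, c)], where locally
    [d a = w c]. *)
Lemma fiber_out_quasi_iso A C (w : chain_map C (shift A)) :
  acyclic A -> quasi_iso (fiber_out w).
Proof.
move=> ac i U; split=> [[a c] /= [/eqP]|c dc].
  rewrite subr_eq0 => /eqP da dc lc.
  apply: (locally_on_bind lc) => V h [c0 ec0].
  have dx : cdiff A (i + 1) V (mres h a + w i V c0) = 0.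
    rewrite mfunD mfun_res da; apply/eqP; rewrite addr_eq0 -mfun_res -ec0.
    by rewrite -(cmap_diff w).
  apply: locally_on_sub (ac _ _ _ dx) => W k [a1 ea1].
  exists ((a1, mres k c0) : fiber w i W); congr (_, _).
    by rewrite ea1 mres_add mfun_res addrK (mres_comp h k (subset_trans k h)).
  by rewrite mfun_res ec0 (mres_comp h k (subset_trans k h)).
have dx : cdiff A (i + 1 + 1) U (w (i + 1) U c) = 0.
  apply: oppr_inj; have := cmap_diff w (i + 1) U c.
  by rewrite dc mfun0 /= oppr0.
apply: locally_on_sub (ac _ _ _ dx) => V h [a ea].
exists ((a, mres h c) : fiber w (i + 1) V).
  by rewrite /= ea !mfun_res subrr dc mres0.
by rewrite /= subrr -(mfun0 (cdiff C i) V); exact: locally_exact_diff.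
Qed.

Lemma fiber_out_null A C (w : chain_map C (shift A)) :
  homotopic (ccomp w (fiber_out w)) (czero _ _).
Proof.
exists (fun i => OModHom (M := fiber w (i + 1)) (N := shift A i)
  (mfun := fun U (x : fiber w (i + 1) U) => - x.1 : shift A i U)
  ltac:(by move=> U a x y /=; rewrite opprD scalerN)
  ltac:(by move=> U V h x /=; rewrite mresN)) => i U x /=.
by rewrite subr0 mfunN opprK opprB subrKC.
Qed.

(** Regard [g] as a map to [(Q[-1])[1]]. As [Q[-1]] is acyclic, the projection from the fiber to [A]
    is a quasi-isomorphism, and it kills [g] up to homotopy. *)
Lemma acyclic_null A Q (g : chain_map A Q) : acyclic Q ->
  exists D (p : chain_map D A), quasi_iso p /\ homotopic (ccomp g p) (czero D Q).
Proof.
move=> acQ; pose w := ccomp (unshift_shift Q) g.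
exists (fiber w), (fiber_out w); split.
  apply/fiber_out_quasi_iso/acyclic_unshift.
  exact: acyclic_retract (shift_unshiftK Q) acQ.
have := homotopic_compl (shift_unshift Q) (fiber_out_null w).
rewrite ccompA /w ccompA unshift_shiftK ccomp_idl.
congr homotopic; apply: chain_map_ext => i U x /=; exact: mfun0.
Qed.

Lemma addrD_subl (V : zmodType) (p q r : V) : p + q + r - p = q + r.
Proof. by rewrite -[p + q + r]addrA [LHS]addrC addKr. Qed.

(* The components of the null-homotopy in A[1] and B are, respectively, the map q
   and a homotopy from g to s q. *)
Lemma cone_in_null A B Q (s : chain_map A B) (g : chain_map Q B) :
  homotopic (ccomp (cone_in s) g) (czero Q (cone s)) ->
  exists q : chain_map Q A, homotopic g (ccomp s q).
Proof.
case=> h hE.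
pose hA i : omod_hom (Q (i + 1)) (A (i + 1)) := mcomp (cone_out s i) (h i).
pose hB i : omod_hom (Q (i + 1)) (B i) := OModHom (M := Q (i + 1)) (N := B i)
  (mfun := fun U x => (h i U x).2)
  ltac:(by move=> U a x y /=; rewrite mfunD mfunZ)
  ltac:(by move=> U V k x /=; rewrite mfun_res).
have [q qE] := @int_descend (fun j => omod_hom (Q j) (A j)) hA.
have qd j U (x : Q j U) : cdiff A j U (q j U x) = q (j + 1) U (cdiff Q j U x).
  elim/int_pred_ind: j x => i x; rewrite !qE /=.
  have /(congr1 (fun z : cone s (i + 1) U => z.1)) /= := hE i U x.
  by rewrite oppr0 addr0 => /esym/addr0_eq; rewrite opprK.
exists (ChainMap qd), hB => i U x /=.
have /(congr1 (fun z : cone s (i + 1) U => z.2)) /= := hE i U x.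
by rewrite oppr0 addr0 => ->; rewrite qE /=; exact: addrD_subl.
Qed.

(** As [cone s] is acyclic, some quasi-isomorphism [p] kills the composite of [f] with [B -> cone s]
    up to homotopy, and the null-homotopy contains a lift of [f p] through [s]. *)
Lemma ore A B C (f : chain_map A B) (s : chain_map C B) : quasi_iso s ->
  exists D (p : chain_map D A) (q : chain_map D C),
    quasi_iso p /\ homotopic (ccomp f p) (ccomp s q).
Proof.
move=> qs.
have [D [p [qp n]]] := acyclic_null (ccomp (cone_in s) f) (quasi_iso_cone qs).
by rewrite -ccompA in n; have [q e] := cone_in_null n; exists D, p, q.
Qed.

Lemma homotopy_cone A B C (s : chain_map A B) (w : chain_map C A) :
  homotopic (ccomp s w) (czero C B) ->
  exists l : chain_map (shift C) (cone s), ccomp (cone_out s) l = cshift w.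
Proof.
case=> h hE.
have ld i U (x : shift C i U) :
    cdiff (cone s) i U (w (i + 1) U x, - h i U x) =
    ((w (i + 1 + 1) U (cdiff (shift C) i U x), - h (i + 1) U (cdiff (shift C) i U x))
      : cone s (i + 1) U).
  rewrite /= !mfunN opprK; congr (_, _); first by rewrite cmap_diff.
  by have := hE i U x; rewrite /= subr0 => ->; rewrite [LHS]addrC addKr.
exists (ChainMap (A := shift C) (B := cone s) (cmap := fun i =>
  OModHom (M := shift C i) (N := cone s i)
  (mfun := fun U x => (w (i + 1) U x, - h i U x) : cone s i U)
  ltac:(by move=> U a x y; congr (_, _); rewrite /= mfunD mfunZ ?opprD ?scalerN)
  ltac:(by move=> U V k x /=; rewrite !mfun_res mresN)) ld).
exact: chain_map_ext.
Qed.

(** The difference [w = u - v] is null after [s], so [w[1]] factors through the acyclic [cone s]. A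
    quasi-isomorphism to [C[1]] killing the factor [l] kills [w[1]], and is then shifted back. *)
Lemma ore_cancel A B C (s : chain_map A B) (u v : chain_map C A) : quasi_iso s ->
  homotopic (ccomp s u) (ccomp s v) ->
  exists D (c : chain_map D C), quasi_iso c /\ homotopic (ccomp u c) (ccomp v c).
Proof.
move=> qs.
pose w := ccomp (ccodiag A) (ccomp (csum_map u (ccomp (copp (idc A)) v)) (cdiag C)).
move=> suv.
have sw : homotopic (ccomp s w) (czero C B).
  case: suv => h hE; exists h => i U x.
  by have := hE i U x; rewrite /= mfunD mfunN subr0.
have [l le] := homotopy_cone sw.
have [E [p [qp]]] := acyclic_null l (quasi_iso_cone qs).
move=> /(homotopic_compl (cone_out s)); rewrite ccompA le => n.
(* Replacing [E] by the isomorphic [(E[-1])[1]] makes the source a shift, so that fullness of the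
   shift applies. *)
pose p' := ccomp p (shift_unshift E).
have [c ec] := cshift_full p'; exists (unshift E), c; split.
  apply: unshift_quasi_iso; rewrite -ec; apply: quasi_iso_comp qp.
  apply: (retract_quasi_iso (unshift_shiftK E)) => i U a da ea.
  have /(congr1 (fun f => cmap f (i + 1) U a)) /= := shift_unshiftK E.
  move=> <-; exact: (locally_exact_map (unshift_shift E)).
have {}n : homotopic (cshift (ccomp w c)) (czero _ _).
  have -> : cshift (ccomp w c) = ccomp (cshift w) (cshift c) by apply: chain_map_ext.
  rewrite -ec /p' ccompA.
  have := homotopic_compr (shift_unshift E) n; congr homotopic.
  exact: chain_map_ext.
have : homotopic (ccomp w c) (czero _ _).
  apply: homotopic_unshift; move: n; congr homotopic; exact: chain_map_ext.
by case=> h hE; exists h => i U x; have := hE i U x; rewrite /= subr0.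
Qed.

End Fractions.

(** * Equality of morphisms of D(X) *)

Section RoofSemantics.
Variables (X : ringed_space) (T : cochain X).
Implicit Types A B C D : cochain X.

(* A roof stands for the morphism numer denom^-1 from A to T, and [roof_map f r r']
   says that r is r' precomposed with f. *)
Record roof A : Type := Roof {
  apex : cochain X;
  denom : chain_map apex A;
  denom_qis : quasi_iso denom;
  numer : chain_map apex T }.

Definition roof_map A B (f : chain_map A B) (r : roof A) (r' : roof B) : Prop :=
  exists D (p : chain_map D (apex r)) (q : chain_map D (apex r')),
    [/\ quasi_iso p,
        homotopic (ccomp f (ccomp (denom r) p)) (ccomp (denom r') q) &
        homotopic (ccomp (numer r) p) (ccomp (numer r') q)].

(** The action is by relations rather than functions: pulling back a roof involves choices, unique
    only up to equivalence, and an inverse acts simply as the converse relation. *)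
Fixpoint roof_rel A B (x : dhom A B) : roof A -> roof B -> Prop :=
  match x with
  | DMap _ _ f => roof_map f
  | DInv _ _ s _ => fun r r' => roof_map s r' r
  | DComp _ _ _ y x => fun r r' => exists2 r0, roof_rel x r r0 & roof_rel y r0 r'
  end.

Lemma roof_map_comp A B C (g : chain_map B C) (f : chain_map A B) r r0 r' :
  roof_map f r r0 -> roof_map g r0 r' -> roof_map (ccomp g f) r r'.
Proof.
move=> [D [p [q [qp e1 e2]]]] [D' [p' [q' [qp' e1' e2']]]].
have [E [a [b [qa ab]]]] := ore q qp'.
exists E, (ccomp p a), (ccomp q' b); split; first exact: quasi_iso_comp.
  rewrite !ccompA; apply: homotopic_trans (homotopic_compr b e1').
  rewrite -!ccompA; apply: homotopic_compl.
  apply: homotopic_trans (homotopic_compl _ ab).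
  by rewrite !ccompA; apply: homotopic_compr; rewrite -!ccompA.
rewrite !ccompA; apply: homotopic_trans (homotopic_compr b e2').
rewrite -!ccompA; apply: homotopic_trans (homotopic_compl _ ab).
by rewrite !ccompA; apply: homotopic_compr.
Qed.

Lemma roof_map_total A B (f : chain_map A B) (r' : roof B) :
  exists r, roof_map f r r'.
Proof.
have [D [p [q [qp e]]]] := ore f (denom_qis r').
exists (Roof qp (ccomp (numer r') q)), D, (idc D), q.
split; rewrite ?ccomp_idr //; [exact: idc_quasi_iso|exact: homotopic_refl].
Qed.

Lemma roof_map_id A (r : roof A) : roof_map (idc A) r r.
Proof.
exists (apex r), (idc _), (idc _); split; first exact: idc_quasi_iso.
  by rewrite ccomp_idl; exact: homotopic_refl.
exact: homotopic_refl.
Qed.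

(** Over the identity, [q] is a quasi-isomorphism too, because [p] and both denominators are; the
    comparison can then be read backwards. *)
Lemma roof_map_sym A (r r' : roof A) : roof_map (idc A) r r' -> roof_map (idc A) r' r.
Proof.
move=> [D [p [q [qp e1 e2]]]]; exists D, q, p; rewrite ccomp_idl in e1 *.
split; [|exact: homotopic_sym|exact: homotopic_sym].
apply: (quasi_iso_cancel (denom_qis r')); apply: homotopic_quasi_iso e1 _.
exact: quasi_iso_comp (denom_qis r).
Qed.

(** The middle roof is [r'] pulled back along [g]. Comparing it with [r] yields two maps to
    [apex r'] that agree only after [denom r'], which [ore_cancel] removes. *)
Lemma roof_map_factor A B C (g : chain_map B C) (f : chain_map A B) r r' :
  roof_map (ccomp g f) r r' -> exists2 r0, roof_map f r r0 & roof_map g r0 r'.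
Proof.
move=> [D [p [q [qp e1 e2]]]].
have [F [t [q0 [qt et]]]] := ore g (denom_qis r').
pose r0 := Roof qt (ccomp (numer r') q0).
exists r0; last first.
  exists F, (idc F), q0; split; rewrite ?ccomp_idr //; first exact: idc_quasi_iso.
  exact: homotopic_refl.
have [E [a [b [qa eab]]]] := ore (ccomp f (ccomp (denom r) p)) qt.
have qab : homotopic (ccomp (denom r') (ccomp q a))
                     (ccomp (denom r') (ccomp q0 b)).
  rewrite !ccompA; apply: homotopic_trans (homotopic_compr b et).
  rewrite -(ccompA g t b); apply: homotopic_trans (homotopic_compl g eab).
  rewrite ccompA; apply: homotopic_compr; rewrite ccompA.
  exact: homotopic_sym.
have [G [c [qc ec]]] := ore_cancel (denom_qis r') qab.
exists G, (ccomp p (ccomp a c)), (ccomp b c); split.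
- by do 2?apply: quasi_iso_comp.
- have := homotopic_compr c eab; by rewrite -!ccompA.
- have := homotopic_compl (numer r') ec; rewrite /= -!ccompA.
  apply: homotopic_trans; have := homotopic_compr (ccomp a c) e2.
  by rewrite -!ccompA.
Qed.

(** This lemma and the next make the relation of a quasi-isomorphism one-to-one up to equivalence,
    as the two inverse laws require. *)
Lemma roof_map_inj A B (s : chain_map A B) r1 r2 r' : quasi_iso s ->
  roof_map s r1 r' -> roof_map s r2 r' -> roof_map (idc A) r1 r2.
Proof.
move=> qs [D [p [q [qp e1 e2]]]] [D' [p' [q' [qp' e1' e2']]]].
have qq' : quasi_iso q'.
  apply: (quasi_iso_cancel (denom_qis r')); apply: homotopic_quasi_iso e1' _.
  by do 2?apply: quasi_iso_comp => //; exact: denom_qis.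
have [E [a [b [qa eab]]]] := ore q qq'.
have e : homotopic (ccomp s (ccomp (denom r1) (ccomp p a)))
                   (ccomp s (ccomp (denom r2) (ccomp p' b))).
  apply: (@homotopic_trans _ _ _ _ (ccomp (denom r') (ccomp q a))).
    by have := homotopic_compr a e1; rewrite -!ccompA.
  apply: homotopic_trans (homotopic_compl _ eab) _; apply: homotopic_sym.
  by have := homotopic_compr b e1'; rewrite -!ccompA.
have [G [c [qc ec]]] := ore_cancel qs e.
exists G, (ccomp p (ccomp a c)), (ccomp p' (ccomp b c)); split.
- by do 2?apply: quasi_iso_comp.
- by rewrite ccomp_idl; rewrite -!ccompA in ec.
have := homotopic_compr (ccomp a c) e2; rewrite -!ccompA => h.
apply: homotopic_trans h _; apply: homotopic_sym.
have := homotopic_compr (ccomp b c) e2'; rewrite -!ccompA => h.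
apply: homotopic_trans h _; apply: homotopic_compl; apply: homotopic_sym.
by have := homotopic_compr c eab; rewrite -!ccompA.
Qed.

Lemma roof_map_fun A B (s : chain_map A B) r r1 r2 : quasi_iso s ->
  roof_map s r r1 -> roof_map s r r2 -> roof_map (idc B) r1 r2.
Proof.
move=> qs [D [p [q [qp e1 e2]]]] [D' [p' [q' [qp' e1' e2']]]].
have [E [a [b [qa eab]]]] := ore p qp'.
exists E, (ccomp q a), (ccomp q' b); split.
- apply: quasi_iso_comp => //; apply: (quasi_iso_cancel (denom_qis r1)).
  apply: homotopic_quasi_iso e1 _.
  by do 2?apply: quasi_iso_comp => //; exact: denom_qis.
- rewrite ccomp_idl.
  have := homotopic_sym (homotopic_compr a e1); rewrite -!ccompA => h.
  apply: homotopic_trans h _.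
  have := homotopic_compr b e1'; rewrite -!ccompA => h.
  by apply: homotopic_trans h; do 2!apply: homotopic_compl.
- have := homotopic_sym (homotopic_compr a e2); rewrite -!ccompA => h.
  apply: homotopic_trans h _.
  have := homotopic_compr b e2'; rewrite -!ccompA => h.
  by apply: homotopic_trans h; apply: homotopic_compl.
Qed.

Lemma roof_relE A B (x : dhom A B) r1 r2 r1' r2' :
  roof_map (idc A) r1 r2 -> roof_map (idc B) r1' r2' ->
  roof_rel x r1 r1' -> roof_rel x r2 r2'.
Proof.
elim: x r1 r2 r1' r2' => {A B} [A B f|A B s qs|A B C y IHy x IHx] r1 r2 r1' r2' e e' /=.
- move/roof_map_sym: e => e h; rewrite -(ccomp_idr f).
  by apply: roof_map_comp e _; rewrite -(ccomp_idl f); apply: roof_map_comp h _.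
- move/roof_map_sym: e' => e' h; rewrite -(ccomp_idr s).
  by apply: roof_map_comp e' _; rewrite -(ccomp_idl s); apply: roof_map_comp h _.
- case=> r0 h h'; exists r0; first exact: IHx (roof_map_id r0) h.
  exact: IHy (roof_map_id r0) e' h'.
Qed.

Lemma roof_rel_deq A B (x y : dhom A B) : deq x y ->
  forall r r', roof_rel x r r' <-> roof_rel y r r'.
Proof.
elim=> {A B x y}.
- by [].
- by move=> A B x y _ IH r r'; rewrite IH.
- by move=> A B x y z _ IH _ IH' r r'; rewrite IH IH'.
- move=> A B C g g' f f' _ IH _ IH' r r' /=.
  by split=> -[r0 h h']; exists r0; rewrite ?IH ?IH' // -?IH -?IH'.
- move=> A B C D h g f r r' /=; split.
    by move=> [r0 [r1 ? ?] ?]; exists r1 => //; exists r0.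
  by move=> [r0 ? [r1 ? ?]]; exists r1 => //; exists r0.
- move=> A B f r r' /=; split=> [[r0 h e]|h]; first exact: roof_relE (roof_map_id r) e h.
  by exists r' => //; exact: roof_map_id.
- move=> A B f r r' /=; split=> [[r0 /roof_map_sym e h]|h].
    exact: roof_relE e (roof_map_id r') h.
  by exists r => //; exact: roof_map_id.
- move=> A B C g f r r' /=; split=> [|[r0]]; first exact: roof_map_factor.
  exact: roof_map_comp.
- move=> A B s qs r r' /=; split=> [[r0]|e]; first exact: roof_map_inj.
  (* Roofs can be pushed forward along [s]: composed with a denominator, it is again a
     denominator. *)
  pose r0 := Roof (quasi_iso_comp (denom_qis r) qs) (numer r).
  have h : roof_map s r r0.
    exists (apex r), (idc _), (idc _); split; first exact: idc_quasi_iso.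
      by rewrite -ccompA; exact: homotopic_refl.
    exact: homotopic_refl.
  exists r0 => //; exact: (roof_relE (x := DMap s) e (roof_map_id r0) h).
- move=> A B s qs r r' /=; split=> [[r0 h h']|e]; first exact: roof_map_fun h h'.
  have [r0 h] := roof_map_total s r; exists r0 => //.
  exact: (roof_relE (x := DMap s) (roof_map_id r0) e h).
Qed.

End RoofSemantics.

Section Roofs.
Variable X : ringed_space.
Implicit Types A B C D : cochain X.

Lemma deq_homotopic A B (u v : chain_map A B) : deq (DMap u) (DMap v) ->
  exists D (p : chain_map D A), quasi_iso p /\ homotopic (ccomp u p) (ccomp v p).
Proof.
(* The map [u] relates the roof of [u] to the tautological roof of [B], hence so does [v]. Unfolded,
   this makes [u p] and [v p] both homotopic to [q]. *)
pose rA := Roof (idc_quasi_iso A) u; pose rB := Roof (idc_quasi_iso B) (idc B).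
move=> /(@roof_rel_deq _ B) /(_ rA rB) /= [uv _].
have /uv[D [p [q []]]] : roof_map u rA rB.
  exists A, (idc A), u; split; first exact: idc_quasi_iso.
    by rewrite ccomp_idl !ccomp_idr; exact: homotopic_refl.
  by rewrite ccomp_idl !ccomp_idr; exact: homotopic_refl.
rewrite /= !ccomp_idl => qp vp up; exists D, p; split=> //.
exact: homotopic_trans up (homotopic_sym vp).
Qed.

End Roofs.

(** * Morphisms of D(X) as roofs *)

#[local] Instance deq_equivalence (X : ringed_space) (A B : cochain X) :
  Equivalence (@deq X A B).
Proof.
by split; [exact: deq_refl|exact: deq_sym|exact: deq_trans].
Qed.

#[local] Instance DComp_deq (X : ringed_space) (A B C : cochain X) :
  Proper (@deq X B C ==> @deq X A B ==> @deq X A C) (@DComp X A B C).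
Proof. by move=> g g' gg' f f' ff'; exact: deq_comp. Qed.

#[local] Hint Resolve deq_refl : core.

(** * Cylinders *)

Section Cylinder.
Local Open Scope ring_scope.
Variable X : ringed_space.
Implicit Types A B C D : cochain X.

(* The cone of a |-> (a, - a): in degree i it is A^(i+1) + A^i + A^i. *)
Definition cyl A : cochain X :=
  cone (ccomp (csum_map (idc A) (copp (idc A))) (cdiag A)).

Definition cyl_inl A : chain_map A (cyl A) :=
  ccomp (cone_in _) (ccomp (csum_map (idc A) (czero A A)) (cdiag A)).

Definition cyl_inr A : chain_map A (cyl A) :=
  ccomp (cone_in _) (ccomp (csum_map (czero A A) (idc A)) (cdiag A)).

Definition cyl_proj A : chain_map (cyl A) A.
Proof.
exists (fun i => OModHom (M := cyl A i) (N := A i)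
  (mfun := fun U (x : cyl A i U) => x.2.1 + x.2.2)
  ltac:(by move=> U a x y /=; rewrite scalerDr addrACA)
  ltac:(by move=> U V h x /=; rewrite mres_add)) => i U x /=.
by rewrite mfunD addrACA subrr add0r.
Defined.

Lemma cyl_proj_quasi_iso A : quasi_iso (cyl_proj A).
Proof.
apply: (@retract_quasi_iso _ _ _ _ (cyl_inl A)).
  by apply: chain_map_ext => i U x /=; rewrite addr0.
move=> i U [a' [a b]] /= [_ e1 _]; apply: locally_on_sub => V h [c ec].
(* The differential of [(a, (0, c))] is [(- d a, (a, d c - a))]; here [a' = - d a] by the cocycle
   condition, and [d c = a + b]. *)
exists ((mres h a, (0, c)) : cyl A i V); congr (_, (_, _)) => /=.
- by rewrite mfun_res -mresN; move: e1 => /addr0_eq <-; rewrite opprK.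
- by rewrite mfun0 addr0.
- by rewrite ec mres_add addKr.
Qed.

(** The homotopy as a map from the cylinder: [(a', (a, b))] goes to [u a + v b + h a'], so the two
    ends restrict to [u] and [v]. *)
Definition cyl_map A B (u v : chain_map A B)
    (h : forall i, omod_hom (A (i + 1)) (B i))
    (hE : forall i U (x : A (i + 1) U),
      u (i + 1) U x - v (i + 1) U x =
      cdiff B i U (h i U x) + h (i + 1) U (cdiff A (i + 1) U x)) :
  chain_map (cyl A) B.
Proof.
pose pr i : omod_hom (cyl A i) (csum A A i) :=
  OModHom (M := cyl A i) (N := csum A A i) (mfun := fun U x => x.2)
    ltac:(by []) ltac:(by []).
exists (fun i => madd (mcomp (ccodiag B i) (mcomp (csum_map u v i) (pr i)))
  (mcomp (h i) (cone_out _ i))) => i U [a' [a b]] /=.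
rewrite !mfunD !mfunN !cmap_diff.
rewrite [cdiff B i U (h i U a')](canRL (addrK _) (esym (hE i U a'))).
by rewrite addrA; congr (_ - _); rewrite [RHS]addrACA [LHS]addrC.
Defined.

End Cylinder.

(** * Homotopic maps and common denominators *)

Section DerivedHoms.
Local Open Scope derived_scope.
Variable X : ringed_space.
Implicit Types A B C D : cochain X.

Lemma section_deq A B (p : chain_map A B) (s : chain_map B A) (qp : quasi_iso p) :
  ccomp p s = idc B -> DMap s =D DInv qp.
Proof.
by move=> e; rewrite -(deq_idr (DInv qp)) -e deq_map deq_assoc deq_invl deq_idl.
Qed.

(** Both ends of the cylinder are sections of the quasi-isomorphism [cyl_proj], so both equal its
    inverse in D(X); [u] and [v] are their composites with the same map [H]. *)
Lemma homotopic_deq A B (u v : chain_map A B) :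
  homotopic u v -> DMap u =D DMap v.
Proof.
case=> h hE.
pose H := cyl_map hE.
have Hl : ccomp H (cyl_inl A) = u.
  by apply: chain_map_ext => i U x /=; rewrite !mfun0 !addr0.
have Hr : ccomp H (cyl_inr A) = v.
  by apply: chain_map_ext => i U x /=; rewrite !mfun0 addr0 add0r.
pose qp := cyl_proj_quasi_iso A.
have il : DMap (cyl_inl A) =D DInv qp.
  by apply: section_deq; apply: chain_map_ext => i U x /=; rewrite addr0.
have ir : DMap (cyl_inr A) =D DInv qp.
  by apply: section_deq; apply: chain_map_ext => i U x /=; rewrite add0r.
by rewrite -Hl -Hr (deq_map H (cyl_inl A)) (deq_map H (cyl_inr A)) il ir.
Qed.

Lemma deq_qis_cancelr A B C (s : chain_map A B) (x y : dhom B C) :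
  quasi_iso s -> x \o DMap s =D y \o DMap s -> x =D y.
Proof.
move=> qs e; rewrite -(deq_idr x) -(deq_idr y) -(deq_invr qs) !deq_assoc.
by rewrite e.
Qed.

(** Induction on words: in a composite [(v t^-1) (u s^-1)], an Ore square turns [t^-1 u] into
    [q p^-1]. *)
Lemma dhom_roof A B (x : dhom A B) :
  exists C (s : chain_map C A) (u : chain_map C B),
    quasi_iso s /\ x \o DMap s =D DMap u.
Proof.
elim: x => {A B} [A B f|A B s qs|A B C y [D [t [v [qt et]]]] x [E [s [u [qs es]]]]].
- exists A, (idc A), f; split; [exact: idc_quasi_iso|exact: deq_idr].
- exists A, s, (idc A); split=> //; exact: deq_invl.
have [F [p [q [qp e]]]] := ore u qt.
exists F, (ccomp s p), (ccomp v q); split; first exact: quasi_iso_comp.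
rewrite !deq_map -et -deq_assoc [X in y \o X]deq_assoc es.
by rewrite -!deq_map (homotopic_deq e) deq_map deq_assoc.
Qed.

Lemma dhom_roof2 A B B' (x : dhom A B) (y : dhom A B') :
  exists C (s : chain_map C A) (u : chain_map C B) (v : chain_map C B'),
    [/\ quasi_iso s, x \o DMap s =D DMap u & y \o DMap s =D DMap v].
Proof.
have [C [s [u [qs es]]]] := dhom_roof x; have [D [t [v [qt et]]]] := dhom_roof y.
have [E [p [q [qp e]]]] := ore s qt.
exists E, (ccomp s p), (ccomp u p), (ccomp v q); split.
- exact: quasi_iso_comp.
- by rewrite !deq_map -es deq_assoc.
- by rewrite (homotopic_deq e) !deq_map -et deq_assoc.
Qed.

Lemma czero_comp A B C (x : dhom A B) : DMap (czero B C) \o x =D DMap (czero A C).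
Proof.
have [D [s [u [qs e]]]] := dhom_roof x; apply: (deq_qis_cancelr qs).
rewrite -deq_assoc e -!deq_map.
by rewrite (_ : ccomp _ u = ccomp (czero A C) s) //; exact: chain_map_ext.
Qed.

End DerivedHoms.

(** * Additivity *)

Section Additivity.
Local Open Scope derived_scope.
Variable X : ringed_space.
Implicit Types A B C D : cochain X.

Lemma deq_map_ext A B (f g : chain_map A B) :
  (forall i U x, f i U x = g i U x) -> DMap f =D DMap g.
Proof. by move=> /chain_map_ext ->. Qed.

Lemma deq_map_id A (e : chain_map A A) :
  (forall i U x, e i U x = x) -> DMap e =D DMap (idc A).
Proof. by move=> eE; apply: deq_map_ext. Qed.

(** As [dshift] is defined on words, each generating relation has to be checked; likewise for the
    two sums below. *)
Lemma dshift_deq A B (x y : dhom A B) : x =D y -> dshift x =D dshift y.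
Proof.
elim=> {A B x y} //=.
- by move=> A B x y _ ->.
- by move=> A B x y z _ -> _ ->.
- by move=> A B D g g' f f' _ -> _ ->.
- by move=> A B D E h g f; exact: deq_assoc.
- by move=> A B f; rewrite deq_map_id ?deq_idl //.
- by move=> A B f; rewrite deq_map_id ?deq_idr //.
- by move=> A B D g f; rewrite -deq_map; apply: deq_map_ext.
- by move=> A B s qs; rewrite deq_invl !deq_map_id //.
- by move=> A B s qs; rewrite deq_invr !deq_map_id //.
Qed.

Lemma dsuml_deq C A B (x y : dhom A B) : x =D y -> dsuml C x =D dsuml C y.
Proof.
elim=> {A B x y} //=.
- by move=> A B x y _ ->.
- by move=> A B x y z _ -> _ ->.
- by move=> A B D g g' f f' _ -> _ ->.
- by move=> A B D E h g f; exact: deq_assoc.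
- by move=> A B f; rewrite deq_map_id ?deq_idl // => i U [].
- by move=> A B f; rewrite deq_map_id ?deq_idr // => i U [].
- by move=> A B D g f; rewrite -deq_map; apply: deq_map_ext.
- by move=> A B s qs; rewrite deq_invl deq_map_id // => i U [].
- by move=> A B s qs; rewrite deq_invr deq_map_id // => i U [].
Qed.

Lemma dsumr_deq C A B (x y : dhom A B) : x =D y -> dsumr C x =D dsumr C y.
Proof.
elim=> {A B x y} //=.
- by move=> A B x y _ ->.
- by move=> A B x y z _ -> _ ->.
- by move=> A B D g g' f f' _ -> _ ->.
- by move=> A B D E h g f; exact: deq_assoc.
- by move=> A B f; rewrite deq_map_id ?deq_idl // => i U [].
- by move=> A B f; rewrite deq_map_id ?deq_idr // => i U [].
- by move=> A B D g f; rewrite -deq_map; apply: deq_map_ext.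
- by move=> A B s qs; rewrite deq_invl deq_map_id // => i U [].
- by move=> A B s qs; rewrite deq_invr deq_map_id // => i U [].
Qed.

Lemma dadd_deq A B (x x' y y' : dhom A B) :
  x =D x' -> y =D y' -> dadd x y =D dadd x' y'.
Proof.
move=> xx' yy'; rewrite /dadd.
by rewrite (dsuml_deq _ xx') (dsumr_deq _ yy').
Qed.

Definition caddm A B (u v : chain_map A B) : chain_map A B :=
  ccomp (ccodiag B) (ccomp (csum_map u v) (cdiag A)).

Lemma deq_qis_inv A B C (s : chain_map A B) (qs : quasi_iso s) (x : dhom B C) y :
  x \o DMap s =D y -> x =D y \o DInv qs.
Proof. by move=> <-; rewrite -deq_assoc deq_invr deq_idr. Qed.

(** Moving [s] across the diagonal puts it on both summands, where it cancels the two inverses in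
    turn: fractions with a common denominator add by numerators. *)
Lemma dadd_comp A B C (s : chain_map A B) (x y : dhom B C) u v : quasi_iso s ->
  x \o DMap s =D DMap u -> y \o DMap s =D DMap v ->
  dadd x y \o DMap s =D DMap (caddm u v).
Proof.
move=> qs /(deq_qis_inv qs) ex /(deq_qis_inv qs) ey.
rewrite (dadd_deq ex ey) /dadd /=.
set s1 := csum_quasi_iso qs (idc_quasi_iso B).
set s2 := csum_quasi_iso (idc_quasi_iso C) qs.
have e1 : DMap (cdiag B) \o DMap s =D
    DMap (csum_map s (idc B)) \o (DMap (csum_map (idc A) s) \o DMap (cdiag A)).
  by rewrite -!deq_map; exact: deq_map_ext.
have e2 : DMap (csum_map u (idc B)) \o DMap (csum_map (idc A) s) =D
    DMap (csum_map (idc C) s) \o DMap (csum_map u (idc A)).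
  by rewrite -!deq_map; exact: deq_map_ext.
rewrite -!deq_assoc e1 (deq_assoc (DInv s1)) deq_invl deq_idl.
rewrite (deq_assoc (DMap (csum_map u _))) e2 -!deq_assoc.
rewrite (deq_assoc (DInv s2)) deq_invl deq_idl -!deq_map; exact: deq_map_ext.
Qed.

(** Over a common denominator [x - y] becomes [u - v], and either side says that [u] and [v] become
    homotopic after a quasi-isomorphism. *)
Lemma dsub_eq0 A B (x y : dhom A B) : x - y =D dzero A B <-> x =D y.
Proof.
have [C [s [u [v [qs ex ey]]]]] := dhom_roof2 x y.
have e : (x - y) \o DMap s =D DMap (caddm u (ccomp (copp (idc B)) v)).
  by apply: dadd_comp => //; rewrite /dopp -deq_assoc ey deq_map.
split=> xy.
  move: e; rewrite xy /dzero czero_comp.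
  move=> /deq_homotopic [D [p [qp /homotopic_sym [h hE]]]].
  have uv : homotopic (ccomp u p) (ccomp v p).
    by exists h => i U z; have := hE i U z; rewrite /= subr0.
  apply: (deq_qis_cancelr qs); rewrite ex ey.
  by apply: (deq_qis_cancelr qp); rewrite -!deq_map; exact: homotopic_deq.
apply: (deq_qis_cancelr qs); rewrite e /dzero czero_comp.
have /deq_homotopic[D [p [qp [h hE]]]] : DMap u =D DMap v by rewrite -ex -ey xy.
apply: (deq_qis_cancelr qp); rewrite -!deq_map; apply: homotopic_deq.
by exists h => i U z; have := hE i U z; rewrite /= subr0.
Qed.

End Additivity.

(** * Completing morphisms of triangles *)

Section FiberMap.
Local Open Scope ring_scope.
Variable X : ringed_space.
Implicit Types A B C D : cochain X.

(** The long exact sequence argument for [A -> B -> C]. The termwise splitting [sg], which need not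
    commute with differentials, lifts a primitive without shrinking the open set. *)
Lemma acyclic_extension A B C (f : chain_map A B) (g : chain_map B C)
    (sg : forall i, omod_hom (C i) (B i)) :
  (forall i U (c : C i U), g i U (sg i U c) = c) ->
  (forall i U (b : B i U), g i U b = 0 -> exists a, b = f i U a) ->
  (forall i U (a : A i U), f i U a = 0 -> a = 0) ->
  acyclic A -> acyclic C -> acyclic B.
Proof.
move=> sgK ker inj acA acC i U b db.
have dgb : cdiff C (i + 1) U (g (i + 1) U b) = 0 by rewrite cmap_diff db mfun0.
apply: (locally_on_bind (acC _ _ _ dgb)) => V h [c ec].
pose b1 := mres h b - cdiff B i V (sg i V c).
have db1 : cdiff B (i + 1) V b1 = 0.
  by rewrite mfunD mfunN mfun_res db mres0 cdiff_cdiff subr0.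
have [a ea] : exists a, b1 = f (i + 1) V a.
  by apply: ker; rewrite mfunD mfunN -cmap_diff sgK ec mfun_res subrr.
have da : cdiff A (i + 1) V a = 0 by apply: inj; rewrite -cmap_diff -ea.
apply: locally_on_sub (acA _ _ _ da) => W k [a' ea'].
exists (f i W a' + mres k (sg i V c)).
rewrite mfunD cmap_diff ea' !mfun_res -ea -mres_add subrK.
by rewrite (mres_comp h k (subset_trans k h)).
Qed.

Lemma addrB_subD (V : zmodType) (p q r s : V) : p + q - (q - r + s) = p - s + r.
Proof. by rewrite -[q - r + s]addrA addrKA opprD opprK addrA addrAC. Qed.

(** The map is [(a, c) |-> (x a + h c, z c)]; the term [h c] makes up for the square commuting only
    up to homotopy. *)
Lemma fiber_map A C A' C' (w : chain_map C (shift A)) (w' : chain_map C' (shift A'))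
    (x : chain_map A A') (z : chain_map C C') :
  homotopic (ccomp w' z) (ccomp (cshift x) w) ->
  exists k : chain_map (fiber w) (fiber w'),
    [/\ ccomp k (fiber_in w) = ccomp (fiber_in w') x,
        ccomp (fiber_out w') k = ccomp z (fiber_out w) &
        quasi_iso x -> quasi_iso z -> quasi_iso k].
Proof.
case=> H HE.
(* The sign accounts for the differential [- d] of [shift A']. *)
have [h hE] := @int_descend (fun j => omod_hom (C j) (A' j)) (fun i => mopp (H i)).
have hd j U (c : C j U) : w' j U (z j U c) - x (j + 1) U (w j U c) =
    cdiff A' j U (h j U c) - h (j + 1) U (cdiff C j U c).
  elim/int_pred_ind: j c => i c; rewrite !hE /= mfunN opprK.
  exact: (HE i U c).
have kd i U (a : fiber w i U) : cdiff (fiber w') i U (x i U a.1 + h i U a.2, z i U a.2)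
    = ((x (i + 1) U (cdiff (fiber w) i U a).1 + h (i + 1) U (cdiff (fiber w) i U a).2,
       z (i + 1) U (cdiff (fiber w) i U a).2) : fiber w' (i + 1) U).
  congr (_, _); rewrite /= ?cmap_diff // mfunD cmap_diff mfunD mfunN.
  have /eqP := hd i U a.2; rewrite subr_eq => /eqP ->.
  exact: addrB_subD.
pose k := ChainMap (A := fiber w) (B := fiber w') (cmap := fun i =>
  OModHom (M := fiber w i) (N := fiber w' i)
  (mfun := fun U a => (x i U a.1 + h i U a.2, z i U a.2) : fiber w' i U)
  ltac:(by move=> U a b c; congr (_, _); rewrite /= !mfunD !mfunZ // scalerDr addrACA)
  ltac:(by move=> U V r b /=; rewrite !mfun_res mres_add)) kd.
exists k; split.
- by apply: chain_map_ext => i U a; congr (_, _); rewrite /= mfun0 // addr0.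
- exact: chain_map_ext.
move=> /quasi_iso_cone acx /quasi_iso_cone acz; apply: cone_quasi_iso.
(* The cone of [k] is an extension of [cone z] by [cone x], split in each degree, so it is acyclic
   when these are. *)
have fd i U (a : cone x i U) : 
 cdiff (cone k) i U ((a.1, 0), (a.2, 0)) =
  ((((cdiff (cone x) i U a).1, 0), ((cdiff (cone x) i U a).2, 0)) : cone k (i + 1) U).
  rewrite /=; congr ((_, _), (_, _)); rewrite /= ?mfun0 ?oppr0 ?subr0 ?addr0 //.
pose f := ChainMap (A := cone x) (B := cone k) (cmap := fun i =>
  OModHom (M := cone x i) (N := cone k i)
  (mfun := fun U a => ((a.1, 0), (a.2, 0)) : cone k i U)
  ltac:(by move=> U a b c; congr ((_, _), (_, _)); rewrite /= scaler0 addr0)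
  ltac:(by move=> U V r b /=; rewrite !mres0)) fd.
have gd i U (a : cone k i U) : 
 cdiff (cone z) i U (a.1.2, a.2.2) =
  (((cdiff (cone k) i U a).1.2, (cdiff (cone k) i U a).2.2) : cone z (i + 1) U) by [].
pose g := ChainMap (A := cone k) (B := cone z) (cmap := fun i =>
  OModHom (M := cone k i) (N := cone z i)
  (mfun := fun U a => (a.1.2, a.2.2) : cone z i U)
  ltac:(by []) ltac:(by [])) gd.
apply: (@acyclic_extension _ _ _ f g (fun i => OModHom (M := cone z i) (N := cone k i)
  (mfun := fun U a => ((0, a.1), (0, a.2)) : cone k i U)
  ltac:(by move=> U a b c; congr ((_, _), (_, _)); rewrite /= scaler0 addr0)
  ltac:(by move=> U V r b /=; rewrite !mres0))) => //.
- by move=> i U [].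
- by move=> i U [[a1 c1] [a c]] /= [-> ->]; exists (a1, a).
- by move=> i U [a1 a] /= [-> ->].
Qed.

(** The fiber of [cone f -> A[1]] has terms [A^i + (A^(i+1) + B^i)]; it is an enlarged model of
    [B]. *)
Definition cone_out_fiber A B (f : chain_map A B) : chain_map (fiber (cone_out f)) B.
Proof.
exists (fun i => OModHom (M := fiber (cone_out f) i) (N := B i)
  (mfun := fun U x => x.2.2 + f i U x.1)
  ltac:(by move=> U a x y /=; rewrite mfunD mfunZ scalerDr addrACA)
  ltac:(by move=> U V h x /=; rewrite mfun_res mres_add)) => i U [a [a' b]] /=.
by rewrite !mfunD mfunN cmap_diff [RHS]addrC subrKA [RHS]addrC.
Defined.

Definition fiber_section A B (f : chain_map A B) : chain_map B (fiber (cone_out f)).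
Proof.
exists (fun i => OModHom (M := B i) (N := fiber (cone_out f) i)
  (mfun := fun U x => (0, (0, x)) : fiber (cone_out f) i U)
  ltac:(by move=> U a x y; congr (_, (_, _)); rewrite /= scaler0 addr0)
  ltac:(by move=> U V h x /=; rewrite !mres0)) => i U b /=.
by rewrite !mfun0 subr0 oppr0 add0r.
Defined.

Lemma cone_out_fiber_quasi_iso A B (f : chain_map A B) : quasi_iso (cone_out_fiber f).
Proof.
apply: (@retract_quasi_iso _ _ _ _ (fiber_section f)).
  by apply: chain_map_ext => i U x /=; rewrite mfun0 addr0.
move=> i U [a [a' b]] /= [/eqP]; rewrite subr_eq0 => /eqP da da' _.
apply: locally_on_sub => V h [y ey].
(* Since [a' = d a], the entry [- a] in the [A[1]] summand of the cone accounts for both [a] and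
   [a']. *)
exists ((0, (- mres h a, y)) : fiber (cone_out f) i V); congr (_, (_, _)) => /=.
- by rewrite mfun0 sub0r opprK.
- by rewrite mfunN opprK mfun_res da.
- by rewrite ey mres_add mfunN mfun_res [LHS]addrC addrK.
Qed.

End FiberMap.

(** * From mapping cones to exact triangles *)

Section Triangles.
Local Open Scope derived_scope.
Variable X : ringed_space.
Implicit Types A B C D E F M N : cochain X.

Lemma cone_completion A B A' B' (f : chain_map A B) (f' : chain_map A' B')
    (x : dhom A A') (z : dhom (cone f) (cone f')) :
  DMap (cone_out f') \o z =D dshift x \o DMap (cone_out f) ->
  exists y : dhom B B',
    y \o DMap f =D DMap f' \o x /\
    z \o DMap (cone_in f) =D DMap (cone_in f') \o y.
Proof.
move=> xz.
have [A1 [r [x1 [qr er]]]] := dhom_roof x.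
have [C1 [s [z1 [qs es]]]] := dhom_roof z.
(* The Ore square supplies a connecting map [q : C2 -> A1[1]] lying over [cone_out f] up to
   homotopy. *)
have [C2 [c [q [qc e]]]] := ore (ccomp (cone_out f) s) (cshift_quasi_iso qr).
have e1 : DMap (ccomp (cone_out f') (ccomp z1 c)) =D DMap (ccomp (cshift x1) q).
  rewrite !deq_map -es deq_assoc deq_assoc xz; have /= <- := dshift_deq er.
  rewrite -!deq_assoc -(deq_map (cshift r)) -(homotopic_deq e).
  by rewrite -!deq_map ccompA.
(* So far the numerators commute with the connecting maps only in D(X); precomposing with [d] makes
   this a homotopy. *)
have [C3 [d [qd e2]]] := deq_homotopic e1.
pose t := ccomp s (ccomp c d); pose z2 := ccomp z1 (ccomp c d).
have qt : quasi_iso t by do 2?apply: quasi_iso_comp.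
have et : z \o DMap t =D DMap z2 by rewrite !deq_map deq_assoc es.
(* On fibers, the denominators induce a quasi-isomorphism [k] and the numerators a map [k']; the
   required map is [k' k^-1], carried over to [B] and [B']. *)
have [k [ki ko /(_ qr qt) qk]] :
  exists k : chain_map (fiber (ccomp q d)) (fiber (cone_out f)),
    [/\ ccomp k (fiber_in _) = ccomp (fiber_in _) r,
        ccomp (fiber_out _) k = ccomp t (fiber_out _) &
        quasi_iso r -> quasi_iso t -> quasi_iso k].
  by apply: fiber_map; have := homotopic_compr d e; rewrite -!ccompA.
have [k' [ki' ko' _]] :
  exists k : chain_map (fiber (ccomp q d)) (fiber (cone_out f')),
    [/\ ccomp k (fiber_in _) = ccomp (fiber_in _) x1,
        ccomp (fiber_out _) k = ccomp z2 (fiber_out _) &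
        quasi_iso x1 -> quasi_iso z2 -> quasi_iso k].
  by apply: fiber_map; move: e2; rewrite -!ccompA.
pose qb := cone_out_fiber_quasi_iso f; pose qb' := cone_out_fiber_quasi_iso f'.
have sec A2 B2 (g : chain_map A2 B2) :
    DMap (fiber_section g) =D DInv (cone_out_fiber_quasi_iso g).
  by apply: section_deq; apply: chain_map_ext => i U b /=; rewrite mfun0 addr0.
exists (DMap (cone_out_fiber f') \o (DMap k' \o (DInv qk \o DInv qb))).
(* Once the fiber is identified with [B2], [fiber_in] becomes [g] and [fiber_out] becomes
   [cone_in g]. *)
have fE A2 B2 (g : chain_map A2 B2) :
    ccomp (cone_out_fiber g) (fiber_in (cone_out g)) = g.
  by apply: chain_map_ext => i U a /=; rewrite add0r.
have inE A2 B2 (g : chain_map A2 B2) : DMap (cone_in g) \o DMap (cone_out_fiber g) =D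
    DMap (fiber_out (cone_out g)).
  rewrite (_ : cone_in g = ccomp (fiber_out (cone_out g)) (fiber_section g)).
    by rewrite deq_map sec -deq_assoc deq_invl deq_idr.
  exact: chain_map_ext.
split.
  apply: (deq_qis_cancelr qr); rewrite -!deq_assoc er.
  have fD : DMap f =D DMap (cone_out_fiber f) \o DMap (fiber_in (cone_out f)).
    by rewrite -deq_map fE.
  rewrite fD -deq_assoc -[DMap (fiber_in _) \o _]deq_map -ki.
  rewrite (deq_assoc (DInv qb)) deq_invl deq_idl (deq_map k) (deq_assoc (DInv qk)).
  rewrite deq_invl deq_idl -!deq_map ki' ccompA fE; exact: deq_refl.
have zE : z \o DMap (fiber_out (cone_out f)) =D
    DMap z2 \o (DMap (fiber_out (ccomp q d)) \o DInv qk).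
  apply: (deq_qis_cancelr qk); rewrite -!deq_assoc -deq_map ko deq_map deq_assoc et.
  by rewrite deq_invl deq_idr.
rewrite deq_assoc inE !deq_assoc -(deq_map _ k') ko' deq_map -(deq_assoc (DMap z2)) -zE.
by rewrite -inE -!deq_assoc deq_invr deq_idr.
Qed.

Lemma triangle_completion M E E' N F F' (a : dhom M E) (b : dhom E E')
    (c : dhom E' (shift M)) (a' : dhom N F) (b' : dhom F F')
    (c' : dhom F' (shift N)) (f : dhom M N) (la : dhom E' F') :
  exact_triangle a b c -> exact_triangle a' b' c' ->
  dshift f \o c =D c' \o la ->
  exists g : dhom E F, g \o a =D a' \o f /\ la \o b =D b' \o g.
Proof.
move=> [A [B [u [al [be [ga [[[al' [al1 al2]] [be' [be1 be2]] [ga' [ga1 ga2]]]]]]]]]].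
move=> [ua vb wc].
move=> [A0 [B0 [u0 [al0 [be0 [ga0 [[iso_al iso_be iso_ga] [ua0 vb0 wc0]]]]]]]].
move: iso_al iso_be iso_ga.
move=> [al0' [al01 al02]] [be0' [be01 be02]] [ga0' [ga01 ga02]] comm.
(* These are [f] and [la] transported to the cone triangles. *)
pose x := al0 \o (f \o al'); pose z := ga0 \o (la \o ga').
have xz : DMap (cone_out u0) \o z =D dshift x \o DMap (cone_out u).
  rewrite /x /z /= !deq_assoc -wc0 -(deq_assoc _ c') -comm.
  have -> : DMap (cone_out u) =D dshift al \o (c \o ga').
    by rewrite deq_assoc wc -deq_assoc ga2 deq_idr.
  have alK : dshift al' \o dshift al =D DMap (idc (shift M)).
    have := dshift_deq al1; rewrite /= => ->; exact: deq_map_ext.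
  by rewrite -!deq_assoc (deq_assoc (dshift al')) alK deq_idl.
have [y [yu yz]] := cone_completion xz.
exists (be0' \o (y \o be)); split.
  rewrite -!deq_assoc ua (deq_assoc y) yu /x -!deq_assoc al1 deq_idr.
  by rewrite (deq_assoc (DMap u0)) -ua0 !deq_assoc be01 deq_idl.
have laE : la =D ga0' \o (z \o ga).
  by rewrite /z -!deq_assoc ga1 deq_idr deq_assoc ga01 deq_idl.
clearbody z; rewrite laE -!deq_assoc vb (deq_assoc z) yz -!deq_assoc.
have -> : DMap (cone_in u0) =D ga0 \o (b' \o be0').
  by rewrite deq_assoc vb0 -deq_assoc be02 deq_idr.
by rewrite !deq_assoc ga01 deq_idl.
Qed.

End Triangles.

(** * The obstruction class *)

Local Open Scope derived_scope.

(* E0 and F0 live on X0 and are regarded in D(X) through the pushforward along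
   i; all morphisms are morphisms of D(X). *)
Theorem corollary4p4 (X0 X : scheme) (i : scheme_hom X0 X)
    (hi : square_zero_extension i)
    (E0 F0 : cochain X0) (hE0 : perfect E0) (hF0 : perfect F0)
    (M E N F : cochain X)
    (a : dhom M E) (b : dhom E (pushforward i E0))
    (c : dhom (pushforward i E0) (shift M)) (hE : exact_triangle a b c)
    (a' : dhom N F) (b' : dhom F (pushforward i F0))
    (c' : dhom (pushforward i F0) (shift N)) (hF : exact_triangle a' b' c')
    (f : dhom M N) (la : dhom (pushforward i E0) (pushforward i F0)) :
  exists o : Ext1 (pushforward i E0) N,
    o =D (c' \o la) - (dshift f \o c) /\
    (o =D dzero (pushforward i E0) (shift N) <->
     exists g : dhom E F,
       g \o a =D a' \o f /\
       la \o b =D b' \o g /\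
       dshift f \o c =D c' \o la).
Proof.
exists ((c' \o la) - (dshift f \o c)); split; first exact: deq_refl.
rewrite dsub_eq0; split=> [/deq_sym comm|[g [_ [_ /deq_sym //]]]].
by have [g [ga gb]] := triangle_completion hE hF comm; exists g.
Qed.
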